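(* Let $\mathcal{A}:=\mathcal{A}(G_{31})$ be the reflection arrangement of the finite complex reflection group $G_{31}$. Let $\tilde{\mathcal{A}}\subseteq\mathcal{A}$ be a smallest (with respect to the number of hyperplanes) free filtration subarrangement of $\mathcal{A}$. Then $\tilde{\mathcal{A}}\cong\mathcal{A}(G_{29})$. In particular, $\mathcal{A}$, $\mathcal{A}(G_{29})$ and all other free filtration subarrangements of $\mathcal{A}$ are not inductively free.
   Context: An $\ell$-arrangement is a finite set $\mathcal{A}$ of linear hyperplanes in a complex vector space $V$ of dimension $\ell$; $\Phi_\ell$ denotes the empty $\ell$-arrangement. Two arrangements are isomorphic ($\cong$) if some linear isomorphism of the ambient spaces maps one onto the other. Let $S=\mathbb{C}[x_1,\ldots,x_\ell]$ be the symmetric algebra of $V^*$ and $Q(\mathcal{A})=\prod_{H\in\mathcal{A}}\alpha_H$ with $H=\ker\alpha_H$. $\mathcal{A}$ is free if $D(\mathcal{A})=\{\theta\in\operatorname{Der}(S)\mid \theta(Q(\mathcal{A}))\in Q(\mathcal{A})S\}$ is a free $S$-module; then $\exp(\mathcal{A})$ is the multiset of polynomial degrees of a homogeneous basis (a derivation $\sum f_i\,\partial/\partial x_i$ has polynomial degree $p$ if all $f_i$ are homogeneous of degree $p$). For $H_0\in\mathcal{A}$ put $\mathcal{A}'=\mathcal{A}\setminus\{H_0\}$ and $\mathcal{A}''=\{H_0\cap H\mid H\in\mathcal{A}\setminus\{H_0\}\}$, an arrangement in $H_0$. The class $\mathcal{IF}$ of inductively free arrangements is the smallest class of arrangements such that: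 (1) $\Phi_\ell\in\mathcal{IF}$ for $\ell\ge0$; (2) if there exists $H_0\in\mathcal{A}$ with $\mathcal{A}''\in\mathcal{IF}$, $\mathcal{A}'\in\mathcal{IF}$ and $\exp(\mathcal{A}'')\subset\exp(\mathcal{A}')$ (as multisets), then $\mathcal{A}\in\mathcal{IF}$. Let $\mathcal{A}$ be a free arrangement and $\tilde{\mathcal{A}}\subseteq\mathcal{A}$ a free subarrangement. $\tilde{\mathcal{A}}$ is a free filtration subarrangement of $\mathcal{A}$ if there is a strictly decreasing sequence of free arrangements $\mathcal{A}=\mathcal{A}_0\supsetneq\mathcal{A}_1\supsetneq\cdots\supsetneq\mathcal{A}_n=\tilde{\mathcal{A}}$ with $|\mathcal{A}_i|=|\mathcal{A}|-i$ for each $i$. $G_{29}$ and $G_{31}$ are the exceptional complex reflection groups in the Shephard--Todd numbering; the reflection arrangement of a reflection group is the set of reflecting hyperplanes of all its reflections. Explicitly, write $\alpha^\perp$ for the kernel of the linear form on $\mathbb{C}^4$ with coefficient row vector $\alpha$, let $i=\sqrt{-1}$, and let $G(4,4,4)$ be the group of $4\times4$ monomial matrices whose nonzero entries are fourth roots of unity with product $1$. Then $\mathcal{A}(G_{31})$ is the set of 60 hyperplanes $$\{\ker(x_p-i^kx_q)\mid 0\le k\le3,\ 1\le p<q\le4\}\ \cup\ \{\alpha^\perp\mid\alpha\in G(4,4,4).(1,1,1,1)\}\ \cup\ \{\ker x_p\mid 1\le p\le4\}\ \cup\ \{\alpha^\perp\mid\alpha\in G(4,4,4).(-1,1,1,1)\},$$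 and $\mathcal{A}(G_{29})$ is the union of the first two sets (40 hyperplanes). *)

(* Defs.v *)
From HB Require Import structures.
From mathcomp Require Import all_boot all_order all_algebra all_fingroup finmap.
From mathcomp Require Import mpoly.

Set Implicit Arguments.
Unset Strict Implicit.
Unset Printing Implicit Defensive.

Import GRing.Theory Num.Theory.
Local Open Scope fset_scope.
Local Open Scope ring_scope.

Section Arrangements.

Variable K : fieldType.

Section AmbientSpace.

Variable V : vectType K.
Implicit Types (A B : {fset {vspace V}}) (H : {vspace V}).

Definition is_hyperplane H : bool := (\dim H).+1 == \dim {:V}.

Definition is_arrangement A : Prop := {in A, forall H, is_hyperplane H}.

Lemma exists_linear_form H :
  exists f : 'Hom(V, K^o), is_hyperplane H ==> (lker f == H).
Proof.
have [/eqP dH | _] := boolP (is_hyperplane H); last by exists 0.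
have HC0 : (H :&: H^C = 0)%VS by rewrite capv_compl.
have CH0 : (H^C :&: H = 0)%VS by rewrite capvC.
have dC : \dim H^C = 1%N.
  apply/eqP; rewrite -(eqn_add2l (\dim H)) -(dimv_disjoint_sum HC0).
  by rewrite addv_complf -dH addn1.
have i0 : 'I_(\dim H^C) by rewrite dC; exact: ord0.
pose f := (linfun (coord (vbasis H^C) i0 : V -> K^o) \o daddv_pi H^C H)%VF.
exists f; apply/eqP/vspaceP => v; rewrite memv_ker comp_lfunE lfunE /=.
have pC : daddv_pi H^C H v \in (H^C)%VS by exact: memv_pi.
have vE : daddv_pi H^C H v + daddv_pi H H^C v = v.
  by apply: daddv_pi_add; rewrite // addvC addv_complf memvf.
apply/eqP/idP => [v0 | vH].
  suff p0 : daddv_pi H^C H v = 0 by rewrite -vE p0 add0r memv_pi.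
  rewrite (coord_vbasis pC) big1 // => i _; suff -> : i = i0 by rewrite v0 scale0r.
  have := ltn_ord i; have := ltn_ord i0; rewrite [X in (_ < X)%N -> _]dC.
  rewrite [X in _ -> (_ < X)%N -> _]dC !ltnS !leqn0 => /eqP e0 /eqP e.
  by apply: val_inj; rewrite /= e e0.
have := vE; rewrite (daddv_pi_id HC0 vH) -[RHS]add0r => /addIr ->.
by rewrite linear0.
Qed.

(* alpha_H: a linear form with kernel H, unique up to a nonzero scalar. *)
Definition linear_form H : 'Hom(V, K^o) := xchoose (exists_linear_form H).

Lemma lker_linear_form H : is_hyperplane H -> lker (linear_form H) = H.
Proof. by move=> hH; apply/eqP/(implyP (xchooseP (exists_linear_form H))). Qed.

(* Sym(V^* ), where 'X_j is the j-th coordinate function in the basis vbasis {:V}. *)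
Local Notation S := {mpoly K[\dim {:V}]}.

Definition poly_of_form (f : 'Hom(V, K^o)) : S :=
  \sum_(j < \dim {:V}) (f (vbasis {:V})`_j : K) *: 'X_j.

Definition defining_poly A : S := \prod_(H <- A) poly_of_form (linear_form H).

Definition is_derivation (theta : {linear S -> S}) : Prop :=
  forall p q, theta (p * q) = theta p * q + p * theta q.

Definition in_D A (theta : {linear S -> S}) : Prop :=
  is_derivation theta /\
  exists q, theta (defining_poly A) = defining_poly A * q.

Definition is_D_basis A n (th : 'I_n -> {linear S -> S}) : Prop :=
  (forall i, in_D A (th i)) /\
  forall eta, in_D A eta ->
    exists! c : 'rV[S]_n, forall p, eta p = \sum_(i < n) c 0 i * th i p.

(* D(A) is a submodule of a free module of finite rank over a Noetherian ring, so
   a basis of it is always finite. *)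
Definition is_free A : Prop :=
  is_arrangement A /\ exists n (th : 'I_n -> {linear S -> S}), is_D_basis A th.

(* The coefficient of theta at d/dx_j is theta 'X_j. *)
Definition has_pdeg (d : nat) (theta : {linear S -> S}) : Prop :=
  forall j, theta 'X_j \is d.-homog.

(* e lists, with multiplicities, the degrees of some homogeneous basis of D(A). *)
Definition is_exp A (e : seq nat) : Prop :=
  exists th : 'I_(size e) -> {linear S -> S},
    is_D_basis A th /\ forall i : 'I_(size e), has_pdeg (nth 0%N e i) (th i).

Definition submultiset (e1 e2 : seq nat) : Prop :=
  forall d, (count_mem d e1 <= count_mem d e2)%N.

(* The intersection of H0 and H, as a subspace of H0. *)
Definition restrict_hyperplane H0 H : {vspace subvs_of H0} :=
  (linfun (vsval : subvs_of H0 -> V) @^-1: H)%VS.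

Definition deletion A H0 : {fset {vspace V}} := A `\ H0.

Definition restriction A H0 : {fset {vspace subvs_of H0}} :=
  [fset restrict_hyperplane H0 H | H in A `\ H0].

Definition free_filtration_sub A B : Prop :=
  exists (n : nat) (F : nat -> {fset {vspace V}}),
    [/\ F 0%N = A, F n = B,
        forall i, (i <= n)%N -> is_free (F i),
        forall i, (i < n)%N -> F i.+1 `<` F i
      & forall i, (i <= n)%N -> (#|` F i| + i)%N = #|` A| ].

Definition smallest_free_filtration_sub A B : Prop :=
  free_filtration_sub A B /\
  forall B', free_filtration_sub A B' -> (#|` B| <= #|` B'|)%N.

End AmbientSpace.

Inductive inductively_free : forall V : vectType K, {fset {vspace V}} -> Prop :=
| IF_empty (V : vectType K) : inductively_free (fset0 : {fset {vspace V}})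
| IF_add (V : vectType K) (A : {fset {vspace V}}) (H0 : {vspace V})
    (e' e'' : seq nat) :
    is_arrangement A -> H0 \in A ->
    inductively_free (restriction A H0) ->
    inductively_free (deletion A H0) ->
    is_exp (restriction A H0) e'' -> is_exp (deletion A H0) e' ->
    submultiset e'' e' ->
    inductively_free A.

Definition isomorphic (V W : vectType K)
    (A : {fset {vspace V}}) (B : {fset {vspace W}}) : Prop :=
  exists f : 'Hom(V, W),
    [/\ lker f = 0%VS, limg f = fullv & [fset (f @: H)%VS | H in A] = B].

End Arrangements.

Section ReflectionArrangements.

Variable C : numClosedFieldType.

(* The hyperplane of C^4 on which the linear form with coefficient row a
   vanishes (all of C^4 if a = 0). *)
Definition perp (a : 'rV[C]_4) : {vspace 'cV[C]_4} :=
  lker (linfun (mulmx a : 'cV[C]_4 -> 'cV[C]_1)).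

Definition monomial_mx (s : 'S_4) (k : {ffun 'I_4 -> 'I_4}) : 'M[C]_4 :=
  \matrix_(i, j) ('i ^+ k i *+ (j == s i)).

(* G(4,4,4). *)
Definition G444 : {fset 'M[C]_4} :=
  [fset monomial_mx t.1 t.2
    | t in {: 'S_4 * {ffun 'I_4 -> 'I_4}} & \prod_(i < 4) ('i : C) ^+ t.2 i == 1].

Definition G444_orbit (v : 'rV[C]_4) : {fset 'rV[C]_4} :=
  [fset (g *m v^T)^T | g in G444].

(* ker (x_p - i^k x_q). *)
Definition ker_diff (p q k : 'I_4) : {vspace 'cV[C]_4} :=
  perp (delta_mx 0 p - 'i ^+ k *: delta_mx 0 q).

Definition A_G29 : {fset {vspace 'cV[C]_4}} :=
  [fset ker_diff t.1.1 t.1.2 t.2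
    | t in {: 'I_4 * 'I_4 * 'I_4} & (t.1.1 < t.1.2)%N]
  `|` [fset perp a | a in G444_orbit (const_mx 1)].

Definition A_G31 : {fset {vspace 'cV[C]_4}} :=
  A_G29
  `|` [fset perp (delta_mx 0 p) | p in 'I_4]
  `|` [fset perp a | a in G444_orbit (\row_j (if j == 0 then -1 else 1))].

End ReflectionArrangements.

Arguments A_G29 C : clear implicits.
Arguments A_G31 C : clear implicits.

(* Main.v *)
Require Import Defs.
From HB Require Import structures.
From Stdlib Require Import ZArith NArith.
From mathcomp Require Import all_boot all_order all_algebra all_fingroup finmap.
From mathcomp Require Import ssrZ zify ring mpoly.
From mathcomp Require Import reals complex.

(* On root lines, the vector field sum_v conj(v) (v.x)^p, p = 1 mod 4, commutes
   with every reflection permuting the lines up to fourth roots of unity, so it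
   is tangent to the mirrors.  Summing over the 60 lines of G31 gives fields of
   degree 13 and 17 in D(A(G31)); summing over a "star" (five mutually unbiased
   bases, 20 lines; there are six stars, permuted transitively by G31) gives a
   field of degree 9 tangent to the other 40 hyperplanes, which form a copy of
   A(G29).  By Saito's criterion and one evaluation of a determinant, deleting
   any subset M of a star leaves a free arrangement with exponents 1, 13, 17,
   29 - |M|, the last field being multiplied by the forms of the star that are
   kept.

   Conversely, if A has homogeneous basis degrees d_j and A \ H is free, then
   A \ H has a homogeneous basis in which one d_j is replaced by d_j - 1, and
   |A| - |A^H| <= d_j because the new basis field phi satisfies: phi(alpha_H)
   restricted to H is nonzero and divisible by Terao's polynomial.  Along a free
   filtration this forces each of the first 13 removals to keep |A^H| = 31, i.e.
   the removed set contains no localisation A_X with X of codimension two.  An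
   exhaustive search shows that such a 13-element set either lies in a star or
   admits no further removal, and once 13 hyperplanes of a star are removed the
   same bound, with |A(G29)^H| = 21, confines the filtration to that star.  So
   filtrations have length at most 20, with equality only for a whole star;
   inductive freeness would instead produce a filtration down to the empty
   arrangement. *)

Set Implicit Arguments.
Unset Strict Implicit.
Unset Printing Implicit Defensive.

Import GRing.Theory Num.Theory.

Delimit Scope Z_scope with BZ.

(** * Root lines, flats and stars of G31 *)

(** Gaussian integers as pairs of binary integers: the finite checks on root lines are run here by
    computation, and [gz] carries them into the field. *)
Definition gint := (Z * Z)%type.
Definition gzero : gint := (0, 0)%BZ.
Definition gone : gint := (1, 0)%BZ.
Definition gtwo : gint := (2, 0)%BZ.
Definition gfour : gint := (4, 0)%BZ.
Definition gadd (x y : gint) : gint := (x.1 + y.1, x.2 + y.2)%BZ.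
Definition gopp (x : gint) : gint := (- x.1, - x.2)%BZ.
Definition gmul (x y : gint) : gint :=
  (x.1 * y.1 - x.2 * y.2, x.1 * y.2 + x.2 * y.1)%BZ.
Definition gconj (x : gint) : gint := (x.1, - x.2)%BZ.
Definition geqb (x y : gint) : bool := Z.eqb x.1 y.1 && Z.eqb x.2 y.2.

Definition ipow (k : nat) : gint :=
  match k with
  | 0 => (1, 0)%BZ | 1 => (0, 1)%BZ | 2 => (- 1, 0)%BZ | _ => (0, - 1)%BZ
  end.

(* The 60 lines of roots of G31, scaled to norm 4: the vectors 2 e_p, then
   (1 + i)(e_p - i^k e_q), then (1, i^a, i^b, i^c) with a + b + c even. *)
Definition root_list : seq (seq gint) :=
  [seq [seq if j == p then (2, 0)%BZ else gzero | j <- iota 0 4] | p <- iota 0 4] ++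
  [seq [seq if j == pq.1 then (1, 1)%BZ else
            if j == pq.2 then gopp (gmul (1, 1)%BZ (ipow k)) else gzero | j <- iota 0 4]
    | pq <- [:: (0, 1); (0, 2); (0, 3); (1, 2); (1, 3); (2, 3)], k <- iota 0 4] ++
  [seq [:: (1, 0)%BZ; ipow abc.1; ipow abc.2.1; ipow abc.2.2]
    | abc <- [seq t <- [seq (a, bc) | a <- iota 0 4,
                         bc <- [seq (b, c) | b <- iota 0 4, c <- iota 0 4]]
               | ~~ odd (t.1 + t.2.1 + t.2.2)]].

Definition root_seq : seq (seq gint) := Eval vm_compute in root_list.
Definition rt (k : nat) : seq gint := nth [::] root_seq k.
Definition ent (v : seq gint) (j : nat) : gint := nth gzero v j.

Definition pairs4 := [:: (0, 1); (0, 2); (0, 3); (1, 2); (1, 3); (2, 3)].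

Definition minor (u v : seq gint) (ij : nat * nat) : gint :=
  gadd (gmul (ent u ij.1) (ent v ij.2)) (gopp (gmul (ent u ij.2) (ent v ij.1))).

Definition indep (u v : seq gint) : bool :=
  has (fun ij => ~~ geqb (minor u v ij) gzero) pairs4.

(* Cramer's rule on two coordinates: w lies in the span of u and v. *)
Definition dep (u v w : seq gint) : bool :=
  has (fun ij => ~~ geqb (minor u v ij) gzero &&
    all (fun j => geqb (gmul (minor u v ij) (ent w j))
      (gadd (gmul (minor w v ij) (ent u j)) (gmul (minor u w ij) (ent v j))))
     (iota 0 4)) pairs4.

(** Comparing with the head of a class suffices, because containing the same codimension-two
    subspace of the hyperplane h is an equivalence relation. The table is certified afterwards by
    [flats_okP]. *)
Fixpoint insert_flat (h k : nat) (cl : seq (seq nat)) : seq (seq nat) :=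
  match cl with
  | [::] => [:: [:: k]]
  | c :: cl' => if dep (rt h) (rt (head 0 c)) (rt k) then rcons c k :: cl'
                else c :: insert_flat h k cl'
  end.

(* The points H cap K of the restriction to H = H_h, each given by the indices
   K <> h of the hyperplanes through it. *)
Definition flats_at (h : nat) : seq (seq nat) :=
  foldl (fun cl k => if k == h then cl else insert_flat h k cl) [::] (iota 0 60).

Definition flat_table : seq (seq (seq nat)) :=
  Eval vm_compute in [seq flats_at h | h <- iota 0 60].

Definition Fl (h : nat) : seq (seq nat) := nth [::] flat_table h.

(* The six complete systems of five mutually unbiased bases; each complement
   is a copy of the arrangement of G29. *)
Definition stars : seq (seq nat) :=
 [:: [:: 0; 1; 2; 3; 29; 30; 32; 35; 36; 38; 41; 43; 44; 47; 49; 50; 53; 55; 56; 58];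
     [:: 0; 1; 2; 3; 28; 31; 33; 34; 37; 39; 40; 42; 45; 46; 48; 51; 52; 54; 57; 59];
     [:: 4; 6; 8; 10; 13; 15; 17; 19; 20; 22; 24; 26; 38; 39; 42; 43; 54; 55; 58; 59];
     [:: 4; 6; 9; 11; 12; 14; 16; 18; 21; 23; 24; 26; 36; 37; 40; 41; 52; 53; 56; 57];
     [:: 5; 7; 8; 10; 12; 14; 16; 18; 20; 22; 25; 27; 30; 31; 34; 35; 46; 47; 50; 51];
     [:: 5; 7; 9; 11; 13; 15; 17; 19; 21; 23; 25; 27; 28; 29; 32; 33; 44; 45; 48; 49]].

(** * Bit masks and the exhaustive search *)

Definition mask (s : seq nat) : N := foldr (fun k m => N.setbit m (N.of_nat k)) N0 s.

Definition flat_masks : seq (seq N) :=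
  Eval vm_compute in [seq [seq mask f | f <- fl] | fl <- flat_table].
Definition star_masks : seq N := Eval vm_compute in [seq mask s | s <- stars].

Fixpoint pow2p (p : positive) : bool :=
  match p with xH => true | xO q => pow2p q | xI _ => false end.

Fixpoint popc (p : positive) : nat :=
  match p with xH => 1 | xO q => popc q | xI q => (popc q).+1 end.
Definition popcount (m : N) : nat := if m is Npos p then popc p else 0.

(** Lowest set bit; it selects the hyperplane to branch on, and the search is sound for any
    choice. *)
Fixpoint ctz (p : positive) : nat :=
  match p with xO q => (ctz q).+1 | _ => 0 end.

Definition is0 (m : N) : bool := if m is N0 then true else false.

Definition in_star (m : N) : bool := has (fun s => is0 (N.ldiff m s)) star_masks.

Definition tb (m : N) (k : nat) : bool := N.testbit m (N.of_nat k).

Definition bitm (k : nat) : N := N.setbit 0 (N.of_nat k).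

Definition pair_masks : seq N := Eval vm_compute in
  [seq mask (flatten [seq f <- fl | size f == 1]) | fl <- flat_table].
Definition triple_masks : seq (seq N) := Eval vm_compute in
  [seq [seq mask f | f <- fl & size f == 2] | fl <- flat_table].

(** Once v has joined ch, drops the candidates that would complete a localisation of two or three
    hyperplanes through v. *)
Definition forb (v : nat) (ch cand : N) : N :=
  foldl (fun c f => let r := N.ldiff f ch in
     if r is Npos p then (if pow2p p then N.ldiff c r else c) else c)
   (N.ldiff cand (nth N0 pair_masks v)) (nth [::] triple_masks v).

(** After 13 removals a further free removal can lose at most one point of the restriction (see
    [chain_star]), so a set for which every remaining hyperplane has lost two points is a dead
    end. *)
Definition leaf (ch : N) : bool :=
  in_star ch ||
  all (fun h => tb ch h ||
    (2 <= count (fun f => is0 (N.ldiff f ch)) (nth [::] flat_masks h))) (iota 0 60).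

(* The candidates to branch on: as long as ch lies in a star, those outside it. *)
Definition outside (ch cand : N) : N :=
  foldr (fun s r => if is0 (N.ldiff ch s) then N.ldiff cand s else r)
    cand star_masks.

(** The sets M under consideration contain ch, lie in the union of ch and cand, and n is the size of
    ch. Sets avoiding v are treated first, then those containing it. A branch closes when 13
    elements are out of reach or when everything lies in one star. *)
Fixpoint search (fuel : nat) (ch : N) (n : nat) (cand : N) : bool :=
  match fuel with
  | 0 => false
  | f.+1 =>
    if n == 13 then leaf ch else
    if n + popcount cand < 13 then true else
    if in_star (N.lor ch cand) then true else
    if outside ch cand is Npos p then
      let v := ctz p in
      let b := bitm v in
      let cand' := N.ldiff cand b in
      let ch' := N.lor ch b in
      if search f ch n cand' then
        (if tb ch v then true else search f ch' n.+1 (forb v ch' cand'))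
      else false
    else false
  end.

(** * Reflections and numerical certificates *)

Definition gsum (s : seq gint) : gint := foldr gadd gzero s.
Definition gpow (x : gint) (k : nat) : gint := ssrnat.iter k (gmul x) gone.

Definition gdot (u v : seq gint) : gint :=
  gsum [seq gmul (ent u j) (ent v j) | j <- iota 0 4].
Definition vconj (v : seq gint) : seq gint := [seq gconj (ent v j) | j <- iota 0 4].

Definition gunits := [seq ipow k | k <- iota 0 4].

(* k' is the image of k under the reflection at h, up to the unit u. *)
Definition refl_unit (h k k' : nat) (u : gint) : bool :=
  let s := gdot (rt k) (vconj (rt h)) in
  geqb (gmul u (gdot (rt h) (vconj (rt k')))) (gopp (gdot (rt h) (vconj (rt k)))) &&
  all (fun j => geqb (gmul gtwo (ent (rt k') j))
    (gmul u (gadd (gmul gtwo (ent (rt k) j)) (gopp (gmul s (ent (rt h) j)))))) (iota 0 4).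

Definition refl_ok (h k k' : nat) : bool := has (refl_unit h k k') gunits.

Definition tau_table : seq (seq nat) := Eval vm_compute in
  [seq [seq find (refl_ok h k) (iota 0 60) | k <- iota 0 60] | h <- iota 0 60].

Definition tau (h k : nat) : nat := nth 0 (nth [::] tau_table h) k.

Definition all60 : seq nat := iota 0 60.

Lemma tau_refl : all (fun h => all (fun k => refl_ok h k (tau h k)) all60) all60.
Proof. by vm_cast_no_check (erefl true). Qed.

Definition stable (h : nat) (s : seq nat) : bool := perm_eq [seq tau h k | k <- s] s.

Lemma stable_all : all (fun h => stable h all60) all60.
Proof. by vm_cast_no_check (erefl true). Qed.

(** The reflections at the 40 hyperplanes outside a star preserve the star; this makes its field of
    degree 9 tangent to them. *)
Lemma stable_star :
  all (fun s => all (fun h => (h \in s) || stable h s) all60) stars.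
Proof. by vm_cast_no_check (erefl true). Qed.

Lemma indep_roots : all (fun h => all (fun k => (h == k) || indep (rt h) (rt k)) all60) all60.
Proof. by vm_cast_no_check (erefl true). Qed.

(** In order: each class lies in one pencil with h, the classes cover everything but h, there are 31
    of them, and a localisation seen from another of its hyperplanes k stays inside the one seen
    from h. *)
Definition flats_ok (h : nat) : bool :=
  [&& all (fun f => all (fun k => [&& k \in all60, k != h &
            all (fun k' => dep (rt h) (rt k) (rt k')) f]) f) (Fl h),
      all (fun k => (k == h) || has (fun f => k \in f) (Fl h)) all60,
      size (Fl h) == 31
    & all (fun f => all (fun k =>
        has (fun f' => all (fun j => j \in h :: f) f') (Fl k)) f) (Fl h)].

Lemma flats_okP : all flats_ok all60.
Proof. by vm_cast_no_check (erefl true). Qed.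

(* The restriction of the arrangement of G29 has 21 hyperplanes. *)
Lemma star_flats : all (fun s => all (fun h => (h \in s) ||
  (count (fun f => ~~ all (fun k => k \in s) f) (Fl h) == 21)) all60) stars.
Proof. by vm_cast_no_check (erefl true). Qed.

Lemma stars_ok : all (fun s => [&& uniq s, size s == 20 & all (fun k => k \in all60) s]) stars.
Proof. by vm_cast_no_check (erefl true). Qed.

(** A point off all 60 hyperplanes, where the determinant of the four basic fields is evaluated. *)
Definition pt : seq gint := [:: (1, 0); (2, 0); (3, 0); (5, 0)]%BZ.

Definition field_at (s : seq nat) (p j : nat) : gint :=
  gsum [seq gmul (gpow (gdot (rt k) pt) p) (ent (vconj (rt k)) j) | k <- s].

(** Values at [pt] of the Euler field and of the fields of degree 9, 13 and 17. *)
Definition num_rows (s : seq nat) : seq (seq gint) :=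
  [:: pt; [seq field_at s 9 j | j <- iota 0 4];
      [seq field_at all60 13 j | j <- iota 0 4]; [seq field_at all60 17 j | j <- iota 0 4]].

Definition others (i : nat) : seq nat := [seq k <- iota 0 4 | k != i].

Definition cof (m : seq (seq gint)) (i j : nat) : gint :=
  let r := others i in let c := others j in
  let e a b := ent (nth [::] m (nth 0 r a)) (nth 0 c b) in
  let m2 a b := gadd (gmul (e 1 a) (e 2 b)) (gopp (gmul (e 1 b) (e 2 a))) in
  let d := gadd (gadd (gmul (e 0 0) (m2 1 2)) (gopp (gmul (e 0 1) (m2 0 2))))
             (gmul (e 0 2) (m2 0 1)) in
  if odd (i + j) then gopp d else d.

(* The adjugate, but only the identity tested in [nonsing] is used. *)
Definition adj4 (m : seq (seq gint)) : seq (seq gint) :=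
  [seq [seq cof m j i | j <- iota 0 4] | i <- iota 0 4].

Definition mul4 (a b : seq (seq gint)) (i j : nat) : gint :=
  gsum [seq gmul (ent (nth [::] a i) k) (ent (nth [::] b k) j) | k <- iota 0 4].

Definition nonsing (m : seq (seq gint)) : bool :=
  let b := adj4 m in let d := mul4 b m 0 0 in
  ~~ geqb d gzero &&
  all (fun i => all (fun j => geqb (mul4 b m i j) (if i == j then d else gzero))
    (iota 0 4)) (iota 0 4).

Lemma num_nonsing : all (fun s => nonsing (num_rows s)) stars.
Proof. by vm_cast_no_check (erefl true). Qed.

Definition comp (M : seq nat) : seq nat := [seq k <- all60 | k \notin M].

Lemma mem_comp M k : (k \in comp M) = (k \notin M) && (k \in all60).
Proof. by rewrite mem_filter. Qed.

Lemma comp_uniq M : uniq (comp M).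
Proof. by rewrite filter_uniq // iota_uniq. Qed.

Lemma comp_sub M : {subset comp M <= all60}.
Proof. by move=> k; rewrite mem_comp => /andP[]. Qed.

Lemma size_diff (M s : seq nat) : uniq M -> uniq s -> {subset M <= s} ->
  (size [seq k <- s | k \notin M] + size M = size s)%N.
Proof.
move=> uM us sub; rewrite -(count_predC (fun k => k \notin M) s) size_filter.
congr (_ + _)%N; rewrite -size_filter; apply: perm_size; apply: uniq_perm => //.
  exact: filter_uniq.
move=> k; rewrite mem_filter /= negbK andb_idr //; exact: sub.
Qed.

Lemma size_comp M : uniq M -> {subset M <= all60} -> (size (comp M) + size M = 60)%N.
Proof. by move=> uM sub; rewrite size_diff ?iota_uniq. Qed.

Lemma comp_anti (M M' : seq nat) : {subset M <= M'} -> {subset comp M' <= comp M}.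
Proof.
move=> sub k; rewrite !mem_comp => /andP[kM' ->]; rewrite andbT.
by apply: contra kM'; exact: sub.
Qed.

Lemma comp_eq (M M' : seq nat) : M =i M' -> comp M = comp M'.
Proof. by move=> e; apply: eq_filter => k; rewrite e. Qed.

Opaque comp.

Definition star0 : seq nat := nth [::] stars 0.

(** A single reflection of G31 carries each star complement to that of [star0], so the six
    complements are isomorphic. *)
Lemma star_refl : all (fun s =>
  has (fun h => perm_eq [seq tau h k | k <- comp s] (comp star0)) all60) stars.
Proof. by vm_cast_no_check (erefl true). Qed.

Lemma norm4 : all (fun h => geqb (gdot (rt h) (vconj (rt h))) gfour) all60.
Proof. by vm_cast_no_check (erefl true). Qed.

(** * Explicit linear forms of the two arrangements *)

Definition diffv (p q k : nat) : seq gint :=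
  [seq if i == p then gone else if i == q then gopp (ipow k) else gzero | i <- iota 0 4].
Definition unitv (p : nat) : seq gint := [seq if i == p then gone else gzero | i <- iota 0 4].
Definition phasev (q : seq nat) : seq gint := [seq ipow (nth 0 q i) | i <- iota 0 4].
Definition negv (i0 : nat) (v : seq gint) : seq gint :=
  [seq if i == i0 then gopp (ent v i) else ent v i | i <- iota 0 4].

Definition index_pairs : seq (nat * nat) := [seq (p, q) | p <- iota 0 4, q <- iota 0 4].
Definition triples : seq (nat * nat * nat) :=
  [seq t <- [seq (pq, k) | pq <- index_pairs, k <- iota 0 4] | t.1.1 < t.1.2].

Definition prodq (q : seq nat) : gint :=
  gmul (ipow (nth 0 q 0)) (gmul (ipow (nth 0 q 1)) (gmul (ipow (nth 0 q 2)) (ipow (nth 0 q 3)))).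

Definition exps2 : seq (seq nat) := [seq [:: c; d] | c <- iota 0 4, d <- iota 0 4].
Definition exps3 : seq (seq nat) := [seq b :: q | b <- iota 0 4, q <- exps2].
Definition quads : seq (seq nat) :=
  [seq q <- [seq a :: q | a <- iota 0 4, q <- exps3] | geqb (prodq q) gone].

(** Permutations fix (1,1,1,1), so its orbit under G(4,4,4) is given by the phases in [quads]
    alone. *)
Definition forms29 : seq (seq gint) :=
  [seq diffv t.1.1 t.1.2 t.2 | t <- triples] ++ [seq phasev q | q <- quads].

(** For (-1,1,1,1) a permutation only moves the place i0 of the sign. *)
Definition forms31 : seq (seq gint) :=
  (forms29 ++ [seq unitv p | p <- iota 0 4]) ++
  [seq negv i0 (phasev q) | i0 <- iota 0 4, q <- quads].

(** The possible ratios between a root of norm 4 and a form of the definition: 2, 1 + i and the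
    units. *)
Definition scalars : seq gint := [:: gtwo; gadd gone (ipow 1)] ++ gunits.

Definition proportional (v : seq gint) (j : nat) : bool :=
  has (fun c => all (fun i => geqb (ent (rt j) i) (gmul c (ent v i))) (iota 0 4)) scalars.

Definition same_lines (l : seq (seq gint)) (s : seq nat) : bool :=
  all (fun v => has (proportional v) s) l && all (fun j => has (proportional^~ j) l) s.

Lemma forms29_lines : same_lines forms29 (comp star0).
Proof. by vm_cast_no_check (erefl true). Qed.

Lemma forms31_lines : same_lines forms31 (comp [::]).
Proof. by vm_cast_no_check (erefl true). Qed.

(** * Sets of 13 removed hyperplanes *)

Lemma tb_succ m k : tb m k.+1 = tb (N.div2 m) k.
Proof. by rewrite /tb Nat2N.inj_succ N.testbit_succ_r_div2 //; lia. Qed.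

Lemma tb_ldiff a b k : tb (N.ldiff a b) k = tb a k && ~~ tb b k.
Proof. exact: N.ldiff_spec. Qed.

Lemma tb_lor a b k : tb (N.lor a b) k = tb a k || tb b k.
Proof. exact: N.lor_spec. Qed.

Lemma tb_bitm k j : tb (bitm k) j = (j == k).
Proof.
rewrite /tb /bitm N.setbit_eqb orbF; apply/idP/eqP => [/N.eqb_spec|->].
  by move/Nat2N.inj.
by apply/N.eqb_spec.
Qed.

Lemma tb_mask s k : tb (mask s) k = (k \in s).
Proof.
elim: s => [|a s IH] //; rewrite /tb /= N.setbit_eqb inE -IH; congr (_ || _).
by apply/N.eqb_spec/eqP => [/Nat2N.inj|->].
Qed.

Lemma is0_ldiff a b k : is0 (N.ldiff a b) -> tb a k -> tb b k.
Proof.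
move=> h ak; apply: contraLR (ak) => bk.
by have := tb_ldiff a b k; rewrite ak bk; case: N.ldiff h.
Qed.

Lemma popcountP m s : uniq s -> {in s, forall k, tb m k} -> size s <= popcount m.
Proof.
(* Bit 0 is split off and the other positions are shifted down, following the recursion on binary
   digits. *)
have aux (t : seq nat) : uniq t ->
    [/\ uniq [seq k.-1 | k <- t & k != 0],
        {in [seq k.-1 | k <- t & k != 0], forall k, k.+1 \in t}
      & size t = size [seq k.-1 | k <- t & k != 0] + (0 \in t)].
  move=> ut; split.
  - rewrite map_inj_in_uniq ?filter_uniq // => -[|x] [|y];
      rewrite ?mem_filter //= => _ _ ->; done.
  - by move=> k /mapP[[|j]]; rewrite mem_filter //= => jt ->.
  - rewrite size_map size_filter -(count_predC (fun k => k != 0)); congr (_ + _).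
    rewrite -count_uniq_mem //; apply: eq_count => k.
    by rewrite /= negbK.
case: m => [|p]; first by case: s => [|k s] // _ /(_ k (mem_head _ _)).
rewrite /popcount; elim: p s => [p IH|p IH|] s us h;
  have [u1 h1 ->] := aux s us.
- rewrite -[X in _ <= X]addn1; apply: leq_add; last by case: (_ \in _).
  by apply: IH => // k /h1 /h; rewrite tb_succ.
- have -> : 0 \in s = false by apply/negP => /h.
  by rewrite addn0; apply: IH => // k /h1 /h; rewrite tb_succ.
- rewrite (_ : [seq _ | k <- s & _] = [::]); first by case: (_ \in _).
  case: [seq _ | k <- s & _] h1 => // k t /(_ k (mem_head _ _)) /h.
  by rewrite tb_succ.
Qed.

Lemma pow2pP p i j : pow2p p -> tb (Npos p) i -> tb (Npos p) j -> i = j.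
Proof.
elim: p i j => [p IH|p IH|] [|i] [|j] //; rewrite ?tb_succ //=.
by move=> hp hi hj; rewrite (IH i j).
Qed.

(* M contains none of the localisations A_X with X of codimension two. *)
Definition valid (M : seq nat) : bool :=
  all (fun h => all (fun f => has (fun k => k \notin M) f) (Fl h)) M.

(** Number of points of the restriction to h that disappear with M: if h remains, the restriction
    keeps 31 - [lost M h] points. *)
Definition lost (M : seq nat) (h : nat) : nat :=
  count (fun f => all (fun k => k \in M) f) (Fl h).

Definition good (M : seq nat) : bool :=
  has (fun s => all (fun k => k \in s) M) stars ||
  all (fun h => (h \in M) || (2 <= lost M h)) (iota 0 60).

Lemma flat_masksE : flat_masks = [seq [seq mask f | f <- fl] | fl <- flat_table].
Proof. by vm_compute. Qed.

Lemma star_masksE : star_masks = [seq mask s | s <- stars].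
Proof. by vm_compute. Qed.

Lemma pair_masksE :
  pair_masks = [seq mask (flatten [seq f <- fl | size f == 1]) | fl <- flat_table].
Proof. by vm_compute. Qed.

Lemma triple_masksE :
  triple_masks = [seq [seq mask f | f <- fl & size f == 2] | fl <- flat_table].
Proof. by vm_compute. Qed.

Lemma in_starP (m : N) (M : seq nat) : in_star m -> {in M, forall k, tb m k} ->
  has (fun s => all (fun k => k \in s) M) stars.
Proof.
rewrite /in_star star_masksE has_map => /hasP[s ss h] hM.
apply/hasP; exists s => //; apply/allP => k /hM km.
by have := is0_ldiff h km; rewrite tb_mask.
Qed.

Lemma leafP ch M : leaf ch -> {in M, forall k, tb ch k} ->
  (forall k, tb ch k -> k \in M) -> good M.
Proof.
move=> /orP[h|/allP h] Mch chM; rewrite /good; first by rewrite (in_starP h).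
apply/orP; right; apply/allP => k k60; have /orP[/chM->//|h2] := h _ k60.
apply/orP; right; apply: leq_trans h2 _; rewrite flat_masksE.
case: (ltnP k (size flat_table)) => ks; last by rewrite nth_default ?size_map.
rewrite (nth_map [::]) // count_map; apply: sub_count => f /= f0.
by apply/allP => j jf; apply: chM; apply: is0_ldiff f0 _; rewrite tb_mask.
Qed.

(** By validity every class at v has an element outside M. If all but one of its elements are
    already in ch, that element is the remaining one, which is therefore no loss as a candidate. *)
Lemma forbP M v ch cand : valid M -> v \in M -> tb ch v ->
  (forall k, tb ch k -> k \in M) ->
  {in M, forall k, tb ch k || tb cand k} ->
  {in M, forall k, tb ch k || tb (forb v ch cand) k}.
Proof.
move=> /allP/(_ v) hv vM chv chM hM; move/(_ vM)/allP: hv => hv.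
have hp : {in M, forall k, tb ch k || tb (N.ldiff cand (nth N0 pair_masks v)) k}.
  move=> k kM; rewrite tb_ldiff; have /orP[->//|->] := hM k kM.
  rewrite pair_masksE; case: (ltnP v (size flat_table)) => ks; last first.
    by rewrite nth_default ?size_map // orbT.
  rewrite (nth_map [::]) // tb_mask; apply/orP; right.
  apply/negP => /flattenP[f]; rewrite mem_filter => /andP[f1 fl].
  case: f f1 fl => [|a [|//]] // _ fl; rewrite inE => /eqP ka.
  by have := hv _ fl; rewrite /= -ka kM.
rewrite /forb; move: hp; move: (N.ldiff cand _) => c; rewrite triple_masksE.
case: (ltnP v (size flat_table)) => ks; last by rewrite nth_default ?size_map.
rewrite (nth_map [::]) //.
have : {subset [seq f <- nth [::] flat_table v | size f == 2] <= Fl v}.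
  by move=> f; rewrite mem_filter => /andP[].
elim: [seq f <- _ | _] c => [|f fl IH] c //= sub hc.
apply: IH => [g gfl|]; first by apply: sub; rewrite inE gfl orbT.
have hf := hv f (sub _ (mem_head _ _)).
case E: (N.ldiff (mask f) ch) => [|p] //; case: ifP => // p2 k kM.
rewrite tb_ldiff; have /orP[->//|->] := hc k kM.
apply/orP; right; apply/negP => kp.
have /hasP[j jf jM] := hf.
have jp : tb (Npos p) j.
  by rewrite -E tb_ldiff tb_mask jf; apply: contra jM; exact: chM.
by move: jM; rewrite (pow2pP p2 jp kp) kM.
Qed.

Lemma searchP fuel ch n cand M : search fuel ch n cand ->
  uniq M -> size M = 13 -> valid M ->
  (forall k, tb ch k -> k \in M) -> count (tb ch) M = n ->
  {in M, forall k, tb ch k || tb cand k} -> good M.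
Proof.
elim: fuel ch n cand => [//|fuel IH] ch n cand /= + uM sM vM chM cM hM.
case: eqP => [n13 hl|_].
  apply: (leafP hl) => //; apply/allP.
  by rewrite all_count cM n13 sM.
case: ltnP => [lt|_].
  have := count_predC (tb ch) M; rewrite cM sM => e.
  have : 13 <= n + popcount cand.
    rewrite -e leq_add2l -size_filter; apply: popcountP; first exact: filter_uniq.
    move=> k; rewrite mem_filter => /andP[/= nk /hM].
    by rewrite (negPf nk).
  by rewrite leqNgt lt.
case: ifP => [hs _|_].
  rewrite /good (in_starP hs) // => k /hM.
  by rewrite tb_lor.
case: (outside _ _) => // p; move: (ctz p) => v.
case: ifP => // h1 h2.
move: h2; case vch: (tb ch v) => h2.
  apply: (IH _ _ _ h1) => // k kM; rewrite tb_ldiff tb_bitm.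
  by case: eqP => [->|_]; rewrite ?vch // andbT; exact: hM.
case vM': (v \in M); last first.
  apply: (IH _ _ _ h1) => // k kM; rewrite tb_ldiff tb_bitm.
  case: eqP => [kv|_]; last by rewrite andbT; exact: hM.
  by move: vM'; rewrite -kv kM.
apply: (IH _ _ _ h2) => //.
- by move=> k; rewrite tb_lor tb_bitm => /orP[/chM|/eqP->].
- have -> : count (tb (N.lor ch (bitm v))) M = count (tb ch) M + count (pred1 v) M.
    rewrite -count_predUI [X in _ + X](_ : _ = 0) ?addn0.
      by apply: eq_count => k; rewrite /= tb_lor tb_bitm.
    apply/eqP; rewrite -leqn0 leqNgt -has_count; apply/hasP => -[k _ /=].
    by case: eqP => [->|_]; rewrite ?vch ?andbF.
  by rewrite cM count_uniq_mem // vM' addn1.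
- apply: forbP => //.
  + by rewrite tb_lor tb_bitm eqxx orbT.
  + by move=> k; rewrite tb_lor tb_bitm => /orP[/chM|/eqP->].
  + move=> k kM; rewrite tb_lor tb_ldiff tb_bitm.
    by case: eqP => [_|_]; rewrite ?orbT // orbF andbT; exact: hM.
Qed.

(** Each recursive call removes a candidate, so fuel 100 exceeds the possible depth for 60
    hyperplanes. *)
Lemma search_true : search 100 0 0 (mask (iota 0 60)) = true.
Proof. by vm_cast_no_check (erefl true). Qed.

Lemma valid13_good M : uniq M -> {subset M <= iota 0 60} -> size M = 13 ->
  valid M -> good M.
Proof.
move=> uM sub sM vM.
apply: (searchP search_true) => //.
  by apply/eqP; rewrite -leqn0 leqNgt -has_count; apply/hasP => -[k _].
by move=> k /sub; rewrite tb_mask.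
Qed.

Local Open Scope fset_scope.
Local Open Scope ring_scope.

(** * Linear forms and logarithmic derivations *)

Section LinearForms.

Variables (K : fieldType) (n : nat).
Local Notation S := {mpoly K[n]}.
Implicit Types (a b u : 'rV[K]_n) (p q : S).

Definition lin a : S := \sum_j a 0 j *: 'X_j.

Lemma lin_is_linear : linear lin.
Proof.
move=> c a b; rewrite /lin scaler_sumr -big_split /=; apply: eq_bigr => j _.
by rewrite !mxE scalerDl scalerA.
Qed.

HB.instance Definition _ :=
  GRing.isLinear.Build K 'rV[K]_n S _ lin lin_is_linear.

Lemma mcoeff_lin a j : (lin a)@_U_(j) = a 0 j.
Proof.
rewrite /lin linear_sum /= (bigD1 j) //= linearZ /= mcoeffXU eqxx mulr1.
rewrite big1 ?addr0 // => i /negPf ij.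
by rewrite linearZ /= mcoeffXU ij mulr0.
Qed.

Lemma lin_eq0 a : (lin a == 0) = (a == 0).
Proof.
apply/eqP/eqP => [a0|->]; last exact: linear0.
by apply/rowP => j; rewrite -mcoeff_lin a0 mcoeff0 mxE.
Qed.

Lemma lin_homog a : lin a \is 1.-homog.
Proof.
apply: rpred_sum => j _; apply: rpredZ.
by rewrite dhomogX /= mdeg1.
Qed.

(** A vector on which the form a takes the value 1, with default 0 for a = 0; it fixes a complement
    to the hyperplane of a. *)
Definition dualv a : 'rV[K]_n :=
  if [pick j | a 0 j != 0] is Some j then (a 0 j)^-1 *: delta_mx 0 j else 0.

Definition dotv a u : K := \sum_j a 0 j * u 0 j.

Lemma dot_dual a : a != 0 -> dotv a (dualv a) = 1.
Proof.
move=> a0; rewrite /dotv /dualv; case: pickP => [j aj|ja0].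
  rewrite (bigD1 j) //= !mxE !eqxx mulr1 mulfV // big1 ?addr0 // => i /negPf ij.
  by rewrite !mxE ij andbF !mulr0.
by case/eqP: a0; apply/rowP => j; have /negbFE/eqP := ja0 j; rewrite mxE.
Qed.

Definition red_tuple a : n.-tuple S :=
  [tuple 'X_j - dualv a 0 j *: lin a | j < n].

(* Restriction to the hyperplane [a = 0], realised inside [S]
   by projecting along the vector [dualv a]. *)
Definition red_lin_at a p : S := p \mPo red_tuple a.

HB.instance Definition _ a :=
  GRing.LRMorphism.copy (red_lin_at a) (comp_mpoly (red_tuple a)).

Lemma redX a j : red_lin_at a 'X_j = 'X_j - dualv a 0 j *: lin a.
Proof. by rewrite /red_lin_at comp_mpolyXU -tnth_nth tnth_mktuple. Qed.

Lemma red_lin a b : red_lin_at a (lin b) = lin (b - dotv b (dualv a) *: a).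
Proof.
rewrite linearB linearZ /= {1 2}/lin linear_sum /=.
transitivity (\sum_j (b 0 j *: 'X_j - (b 0 j * dualv a 0 j) *: lin a)).
  apply: eq_bigr => j _.
  by rewrite linearZ /= redX scalerBr scalerA.
by rewrite big_split /= sumrN -scaler_suml.
Qed.

Lemma red_lin0 a : a != 0 -> red_lin_at a (lin a) = 0.
Proof. by move=> a0; rewrite red_lin dot_dual // scale1r subrr linear0. Qed.

(** Substitution changes each variable by a multiple of [lin a], hence every polynomial too. So the
    kernel of the restriction is the ideal of [lin a], as used in [dvd_lin]. *)
Lemma red_mod a p : exists q, p = red_lin_at a p + lin a * q.
Proof.
elim/mpolyind: p => [|c m p _ _ [q pq]].
  by exists 0; rewrite linear0 mulr0 addr0.
suff [r Xr] : exists r, 'X_[m] = red_lin_at a 'X_[m] + lin a * r.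
  exists (c%:MP * r + q); rewrite linearD linearZ /= {1}pq {1}Xr.
  by rewrite -!mul_mpolyC; ring.
rewrite mpolyXE_id rmorph_prod /=.
elim/big_ind2: _ => [|x1 x2 y1 y2 [r1 e1] [r2 e2]|i _].
- by exists 0; rewrite mulr0 addr0.
- by exists (x1 * r2 + r1 * (y1 + lin a * r2)); rewrite e1 e2; ring.
- rewrite rmorphXn /= redX.
  elim: (m i) => [|k [r IH]]; first by exists 0; rewrite mulr0 addr0.
  exists ('X_i * r + (dualv a 0 i)%:MP * ('X_i - dualv a 0 i *: lin a) ^+ k).
  by rewrite exprS {1}IH exprS -!mul_mpolyC; ring.
Qed.

Definition mdvd p q := exists r, q = p * r.

Lemma dvdM p q r : mdvd p q -> mdvd p (q * r).
Proof. by case=> s ->; exists (s * r); rewrite mulrA. Qed.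

Lemma dvdD p q r : mdvd p q -> mdvd p r -> mdvd p (q + r).
Proof. by case=> s -> [t ->]; exists (s + t); rewrite mulrDr. Qed.

Lemma dvd0 p : mdvd p 0.
Proof. by exists 0; rewrite mulr0. Qed.

Lemma dvd_lin a p : a != 0 -> mdvd (lin a) p <-> red_lin_at a p = 0.
Proof.
move=> a0; split=> [[q ->]|p0]; first by rewrite rmorphM /= red_lin0 // mul0r.
by have [q ->] := red_mod a p; exists q; rewrite p0 add0r.
Qed.

(** The restriction is a ring morphism into a domain whose kernel is the ideal of [lin a]. *)
Lemma lin_prime a p q : a != 0 -> mdvd (lin a) (p * q) ->
  mdvd (lin a) p \/ mdvd (lin a) q.
Proof.
move=> a0 /(dvd_lin _ a0); rewrite rmorphM /= => /eqP.
by rewrite mulf_eq0 => /orP[] /eqP h; [left|right]; apply/dvd_lin.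
Qed.

Definition parallel a b := exists c, b = c *: a.

Lemma dvd_lin_lin a b : a != 0 -> mdvd (lin a) (lin b) -> parallel a b.
Proof.
move=> a0 /(dvd_lin _ a0); rewrite red_lin => /eqP; rewrite lin_eq0 subr_eq0.
by move=> /eqP e; exists (dotv b (dualv a)).
Qed.

Definition distinct_lines (l : seq 'rV[K]_n) :=
  [/\ uniq l, forall a, a \in l -> a != 0
    & forall a b, a \in l -> b \in l -> parallel a b -> a = b].

Lemma simple_sub l l' : distinct_lines l -> uniq l' -> {subset l' <= l} -> distinct_lines l'.
Proof.
case=> _ l0 lp u s; split=> // [a /s /l0 //|a b /s al /s bl]; exact: lp.
Qed.

Definition prod_lin (l : seq 'rV[K]_n) : S := \prod_(a <- l) lin a.

Lemma Q_neq0 l : distinct_lines l -> prod_lin l != 0.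
Proof.
case=> _ l0 _; rewrite /prod_lin prodf_seq_neq0; apply/allP => a al.
by rewrite implyTb lin_eq0 l0.
Qed.

Lemma dvd_Q_not_lin a l : a != 0 -> (forall b, b \in l -> ~ parallel a b) ->
  ~ mdvd (lin a) (prod_lin l).
Proof.
move=> a0; elim: l => [_ [q e]|b l IH h].
  have := congr1 (meval (fun=> 0)) e; rewrite /prod_lin big_nil meval1 mevalM.
  rewrite /lin raddf_sum /= big1 ?mul0r => [/eqP|j _]; first by rewrite oner_eq0.
  by rewrite mevalZ mevalXU mulr0.
rewrite /prod_lin big_cons => /(lin_prime a0) [].
  by move/(dvd_lin_lin a0); apply: h; rewrite mem_head.
by apply: IH => c cl; apply: h; rewrite inE cl orbT.
Qed.

(** Pairwise non-parallel linear forms are non-associate primes, so they can be divided out one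
    after another. *)
Lemma dvd_prod l p : distinct_lines l -> (forall a, a \in l -> mdvd (lin a) p) ->
  mdvd (prod_lin l) p.
Proof.
elim: l p => [|a l IH] p sl h; first by exists p; rewrite /prod_lin big_nil mul1r.
have /andP[al ul] : uniq (a :: l) by case: sl.
have sl' : distinct_lines l.
  by apply: simple_sub sl ul _ => b bl; rewrite inE bl orbT.
have a0 : a != 0 by case: sl => _ h0 _; apply: h0; rewrite mem_head.
have [q qE] : mdvd (prod_lin l) p.
  by apply: IH => // b bl; apply: h; rewrite inE bl orbT.
have : mdvd (lin a) (prod_lin l * q) by rewrite -qE; apply: h; rewrite mem_head.
case/(lin_prime a0) => [|[r rE]].
  move/dvd_Q_not_lin => -/(_ a0) []; move=> b bl ab.
  case: sl => _ _ /(_ a b); rewrite mem_head inE bl orbT => /(_ isT isT ab) e.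
  by rewrite e bl in al.
by exists r; rewrite /prod_lin big_cons qE rE; rewrite mulrCA mulrA.
Qed.

End LinearForms.

(** * Tangent fields and Saito's criterion *)

Section Derivations.

Variables (K : fieldType) (n : nat).
Local Notation S := {mpoly K[n]}.
Implicit Types (a b u : 'rV[K]_n) (p q : S) (f g : 'rV[S]_n) (l : seq 'rV[K]_n).

(* The row f stands for the derivation sum_j f_j d/dx_j. *)
Definition der_lin f a : S := \sum_j a 0 j *: f 0 j.

(** D(A) tested form by form rather than on the product Q; [theta_Q] gives the equivalence. *)
Definition inD l f := forall a, a \in l -> mdvd (lin a) (der_lin f a).

Definition D_basis l m (Th : 'M[S]_(m, n)) :=
  (forall i, inD l (row i Th)) /\
  forall f, inD l f -> exists! c : 'rV[S]_m, f = c *m Th.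

Lemma appDl f g a : der_lin (f + g) a = der_lin f a + der_lin g a.
Proof.
by rewrite /der_lin -big_split; apply: eq_bigr => j _; rewrite mxE scalerDr.
Qed.

Lemma appZl p f a : der_lin (p *: f) a = p * der_lin f a.
Proof.
by rewrite /der_lin mulr_sumr; apply: eq_bigr => j _; rewrite mxE scalerAr.
Qed.

Lemma appDr f a b : der_lin f (a + b) = der_lin f a + der_lin f b.
Proof.
by rewrite /der_lin -big_split; apply: eq_bigr => j _; rewrite mxE scalerDl.
Qed.

Lemma appZr f (x : K) a : der_lin f (x *: a) = x *: der_lin f a.
Proof.
by rewrite /der_lin scaler_sumr; apply: eq_bigr => j _; rewrite mxE scalerA.
Qed.

Lemma inD0 l : inD l 0.
Proof.
by move=> a _; rewrite -(scale0r 0) appZl mul0r; exact: dvd0.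
Qed.

Lemma inDD l f g : inD l f -> inD l g -> inD l (f + g).
Proof. by move=> hf hg a al; rewrite appDl; apply: dvdD; [apply: hf|apply: hg]. Qed.

Lemma inDZ l p f : inD l f -> inD l (p *: f).
Proof. by move=> hf a al; rewrite appZl mulrC; apply: dvdM; apply: hf. Qed.

Lemma inD_mul l m (Th : 'M[S]_(m, n)) (c : 'rV[S]_m) :
  (forall i, inD l (row i Th)) -> inD l (c *m Th).
Proof.
move=> h; rewrite mulmx_sum_row; elim/big_ind: _ => [||i _].
- exact: inD0.
- exact: inDD.
- exact: inDZ.
Qed.

Lemma inD_sub l l' f : {subset l' <= l} -> inD l f -> inD l' f.
Proof. by move=> s h a /s; exact: h. Qed.

Lemma inD_cons l a f : inD l f -> inD (a :: l) (lin a *: f).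
Proof.
move=> h b; rewrite inE => /orP[/eqP->|bl]; last by apply: inDZ bl; exact: h.
by rewrite appZl; exists (der_lin f a).
Qed.

(** Restricted to the hyperplane of a, the matrix kills the nonzero constant column a, so its
    determinant vanishes there. *)
Lemma dvd_det l (M : 'M[S]_n) : distinct_lines l -> (forall i, inD l (row i M)) ->
  mdvd (prod_lin l) (\det M).
Proof.
move=> sl h; apply: dvd_prod => // a al.
have a0 : a != 0 by case: sl => _ + _; exact.
apply/dvd_lin => //; rewrite -det_map_mx.
set M' := map_mx _ M; pose v : 'cV[S]_n := \col_j (a 0 j)%:MP.
have Mv : M' *m v = 0.
  apply/colP => i; rewrite !mxE.
  have /(dvd_lin _ a0) := h i _ al; rewrite /der_lin rmorph_sum /= => {2}<-.
  apply: eq_bigr => j _; rewrite !mxE linearZ /= mulrC.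
  by rewrite mul_mpolyC.
have [j aj] : exists j, a 0 j != 0 by apply/rV0Pn.
have /colP/(_ j) : \adj M' *m (M' *m v) = 0 by rewrite Mv mulmx0.
rewrite mulmxA mul_adj_mx mul_scalar_mx !mxE => /eqP.
by rewrite mulf_eq0 mpolyC_eq0 (negPf aj) orbF => /eqP.
Qed.

Definition rrow (j : 'I_n) f (M : 'M[S]_n) : 'M[S]_n :=
  \matrix_(i, k) if i == j then f 0 k else M i k.

Lemma row_rrow j f M i : row i (rrow j f M) = if i == j then f else row i M.
Proof. by apply/rowP => k; rewrite !mxE; case: ifP; rewrite ?mxE. Qed.

(** Cramer's rule: the cofactors along row j do not see that row. *)
Lemma det_rrow j f M : \det (rrow j f M) = (f *m \adj M) 0 j.
Proof.
rewrite (expand_det_row _ j) mxE; apply: eq_bigr => k _.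
rewrite mxE eqxx; congr (_ * _); rewrite mxE /cofactor; congr (_ * \det _).
apply/matrixP => r s; rewrite !mxE.
by rewrite eq_sym (negPf (neq_lift _ _)).
Qed.

Lemma mulmx_inj m (M : 'M[S]_n) (A B : 'M[S]_(m, n)) :
  \det M != 0 -> A *m M = B *m M -> A = B.
Proof.
move=> d0 /(congr1 (mulmx^~ (\adj M))); rewrite -!mulmxA mul_mx_adj.
rewrite !mul_mx_scalar => /matrixP h; apply/matrixP => i j.
by have := h i j; rewrite !mxE; apply: mulfI.
Qed.

(** By Cramer the coordinates of f are quotients of determinants by det M. Each numerator again has
    rows in D(A), so [dvd_det] makes the quotient a polynomial. *)
Lemma saito_criterion l (M : 'M[S]_n) c : distinct_lines l -> (forall i, inD l (row i M)) ->
  c != 0 -> \det M = c *: prod_lin l -> D_basis l M.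
Proof.
move=> sl h c0 dM.
have d0 : \det M != 0.
  by rewrite dM -mul_mpolyC mulf_neq0 ?mpolyC_eq0 ?Q_neq0.
split=> // f fD.
have [x xE] : exists x : 'rV[S]_n, f *m \adj M = prod_lin l *: x.
  have : forall j, exists y, (f *m \adj M) 0 j = prod_lin l * y.
    move=> j; rewrite -det_rrow; apply: dvd_det => // i.
    by rewrite row_rrow; case: ifP.
  case/fin_all_exists => y yE; exists (\row_j y j).
  by apply/rowP => j; rewrite yE !mxE.
have fE : f = ((c^-1)%:MP *: x) *m M.
  apply: (@mulmx_inj _ (\adj M)).
    rewrite -[X in X != _]mul1r; apply/eqP => e0.
    have := congr1 determinant (mul_mx_adj M).
    rewrite det_mulmx det_scalar -[\det (\adj M)]mul1r e0 mulr0 => /esym/eqP.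
    by rewrite expf_eq0 (negPf d0) andbF.
  rewrite -mulmxA mul_mx_adj mul_mx_scalar xE dM; apply/rowP => j; rewrite !mxE.
  by rewrite -!mul_mpolyC mulrACA -mpolyCM mulfV // mul1r.
exists ((c^-1)%:MP *: x); split=> // y; rewrite {1}fE.
exact: mulmx_inj.
Qed.

End Derivations.

(** * Homogeneous components and homogeneous bases *)

Section Grading.

Variables (K : fieldType) (n : nat).
Local Notation S := {mpoly K[n]}.
Implicit Types (p q : S) (a b : 'rV[K]_n) (f : 'rV[S]_n) (l : seq 'rV[K]_n).

Lemma pihomogM d e p q : q \is e.-homog ->
  pihomog mdeg d (p * q) =
  if (e <= d)%N then pihomog mdeg (d - e) p * q else 0.
Proof.
(* The decomposition of p is extended past its degree, so that d - e is always one of the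
   indices. *)
move=> hq; rewrite {1}[p](pihomog_partitionE (leq_addr d.+1 (msize p))).
rewrite mulr_suml raddf_sum /=.
have hM i : pihomog mdeg i p * q \is (i + e).-homog.
  by apply: dhomogM => //; exact: pihomogP.
case: leqP => [ed|de]; last first.
  rewrite big1 // => i _; apply: pihomog_ne0 (hM i).
  by rewrite eq_sym neq_ltn (leq_trans de) ?leq_addl.
have lt : (d - e < msize p + d.+1)%N.
  by rewrite (leq_ltn_trans (leq_subr _ _)) // addnS ltnS leq_addl.
rewrite (bigD1 (Ordinal lt)) //= big1 ?addr0.
  by apply: pihomog_dE; have := hM (d - e)%N; rewrite subnK.
move=> i ne; apply: pihomog_ne0 (hM i).
apply: contra_neq ne => /(congr1 (subn^~ e)); rewrite addnK => di.
exact: val_inj.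
Qed.

Lemma pihomog0E p : pihomog mdeg 0 p = (p@_0)%:MP.
Proof.
apply/mpolyP => m; rewrite pihomogE raddf_sum mcoeffC /= eq_sym.
transitivity (\sum_(i <- msupp p | mdeg i == 0%N) p@_i * (i == m)%:R).
  by apply: eq_bigr => i _; rewrite linearZ /= mcoeffX.
rewrite (eq_bigl (fun i => i == 0%MM)) => [|i]; last by rewrite mdeg_eq0.
rewrite -big_filter; case: (boolP (0%MM \in msupp p)) => [p0|p0].
  by rewrite filter_pred1_uniq ?msupp_uniq // big_seq1 eq_sym.
rewrite (memN_msupp_eq0 p0) mul0r big1_seq // => i /=.
by rewrite mem_filter => /andP[/eqP-> i0]; rewrite i0 in p0.
Qed.

Lemma mcoeff0_lin a : (lin a)@_0%MM = 0.
Proof.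
have := pihomog0E (lin a); rewrite (pihomog_ne0 _ (lin_homog a)) //.
by move/esym/eqP; rewrite mpolyC_eq0 => /eqP.
Qed.

Lemma mderiv_lin a j : mderiv j (lin a) = (a 0 j)%:MP.
Proof.
rewrite /lin linear_sum /= (bigD1 j) //= big1 ?addr0.
  rewrite linearZ /= mderivX mnmE eqxx scale1r.
  have -> : (U_(j) - U_(j) = 0)%MM by apply/mnmP => i; rewrite !mnmE subnn.
  by rewrite mpolyX0 alg_mpolyC.
move=> i /negPf ij; rewrite linearZ /= mderivX mnmE ij scale0r scaler0.
by [].
Qed.

Definition pi_row d f : 'rV[S]_n := map_mx (pihomog mdeg d) f.

Lemma app_pi_row d f a : der_lin (pi_row d f) a = pihomog mdeg d (der_lin f a).
Proof.
by rewrite /der_lin linear_sum; apply: eq_bigr => j _; rewrite mxE linearZ.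
Qed.

Lemma dvd_pihomog d a p : mdvd (lin a) p -> mdvd (lin a) (pihomog mdeg d p).
Proof.
move=> [q ->]; rewrite mulrC (pihomogM _ _ (lin_homog a)); case: ifP => _.
  by rewrite mulrC; exists (pihomog mdeg (d - 1) q).
exact: dvd0.
Qed.

Lemma inD_pi_row l d f : inD l f -> inD l (pi_row d f).
Proof. by move=> h a al; rewrite app_pi_row; apply: dvd_pihomog; exact: h. Qed.

(** The form of freeness carried along a filtration: homogeneous rows of degrees d satisfying
    Saito's criterion. *)
Definition hbasis l (d : 'I_n -> nat) (M : 'M[S]_n) :=
  [/\ forall i, inD l (row i M),
      forall i k, M i k \is (d i).-homog
    & exists2 c, c != 0 & \det M = c *: prod_lin l].

Lemma hbasis_basis l d M : distinct_lines l -> hbasis l d M -> D_basis l M.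
Proof. by move=> sl [hD _ [c c0 dM]]; exact: saito_criterion hD c0 dM. Qed.

Lemma dhomog_big (I : Type) (r : seq I) (d : I -> nat) (F : I -> S) :
  (forall i, F i \is (d i).-homog) ->
  \prod_(i <- r) F i \is (\sum_(i <- r) d i).-homog.
Proof.
move=> h; elim: r => [|i r IH]; first by rewrite !big_nil dhomog1.
by rewrite !big_cons; apply: dhomogM.
Qed.

Lemma Q_homog l : prod_lin l \is (size l).-homog.
Proof.
rewrite -sum1_size; apply: (@dhomog_big _ l (fun=> 1%N)) => a.
exact: lin_homog.
Qed.

Lemma det_homog (d : 'I_n -> nat) (M : 'M[S]_n) :
  (forall i k, M i k \is (d i).-homog) -> \det M \is (\sum_i d i).-homog.
Proof.
move=> h; apply: rpred_sum => s _; rewrite mulr_sign.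
have hp : \prod_i M i (s i) \is (\sum_i d i).-homog by exact: dhomog_big.
by case: odd_perm => //; rewrite rpredN.
Qed.

Lemma msize_homog d p : p != 0 -> p \is d.-homog -> msize p = d.+1.
Proof.
move=> p0 hp; have := dhomog_uniq p0 hp (dhomog_msize hp).
by move->; rewrite -mpolySpred.
Qed.

(* Since Q | det and the degrees agree, the quotient is a constant. *)
Lemma hbasis_deg l d M : distinct_lines l -> (forall i, inD l (row i M)) ->
  (forall i k, M i k \is (d i).-homog) -> \det M != 0 ->
  (\sum_i d i = size l)%N -> hbasis l d M.
Proof.
move=> sl hD hH d0 sd; split=> //.
have [q qE] := dvd_det sl hD.
have q0 : q != 0 by apply: contra_neq d0 => q0; rewrite qE q0 mulr0.
have := msizeM (Q_neq0 sl) q0; rewrite -qE.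
rewrite (msize_homog d0 (det_homog hH)) (msize_homog (Q_neq0 sl) (Q_homog l)) sd.
rewrite addSn /= -[X in X = _]addn1 => /addnI/esym/eqP/msize_poly1P[c c0 qc].
by exists c => //; rewrite qE qc mulrC mul_mpolyC.
Qed.

End Grading.

(** * Removing a hyperplane from a free arrangement *)

Section Exchange.

Variables (K : fieldType) (n : nat).
Local Notation S := {mpoly K[n]}.
Local Notation ev0 := (mcoeff 0%MM : S -> K).
Implicit Types (p q : S) (a b : 'rV[K]_n) (f : 'rV[S]_n) (l : seq 'rV[K]_n).

Lemma basis_inj l m (Th : 'M[S]_(m, n)) (c c' : 'rV[S]_m) :
  D_basis l Th -> c *m Th = c' *m Th -> c = c'.
Proof.
move=> [hD hB] e; have [x [_ xu]] := hB _ (inD_mul c hD).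
by rewrite -(xu c) // -(xu c').
Qed.

Lemma basis_mx l m k (Th : 'M[S]_(m, n)) (N : 'M[S]_(k, n)) :
  D_basis l Th -> (forall i, inD l (row i N)) -> exists C, N = C *m Th.
Proof.
move=> [hD hB] hN.
have : forall i, exists c, row i N = c *m Th.
  by move=> i; have [c [cE _]] := hB _ (hN i); exists c.
case/fin_all_exists => c cE; exists (\matrix_i c i).
by apply/row_matrixP => i; rewrite row_mul rowK cE.
Qed.

Lemma basis_injmx l m k (Th : 'M[S]_(m, n)) (A B : 'M[S]_(k, m)) :
  D_basis l Th -> A *m Th = B *m Th -> A = B.
Proof.
move=> hB e; apply/row_matrixP => i; apply: (basis_inj hB).
by rewrite -!row_mul e.
Qed.

Section Transition.

Variables (a : 'rV[K]_n) (l : seq 'rV[K]_n) (m : nat).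
Variables (d : 'I_n -> nat) (Th : 'M[S]_n) (eta : 'M[S]_(m, n)).
Hypotheses (sl : distinct_lines (a :: l)) (hTh : hbasis (a :: l) d Th)
  (heta : D_basis l eta).

Let a0 : a != 0.
Proof. by case: sl => _ + _; apply; rewrite mem_head. Qed.

Let sl' : distinct_lines l.
Proof.
have ul : uniq l by case: sl => /andP[].
by apply: simple_sub sl ul _ => b bl; rewrite inE bl orbT.
Qed.

Lemma not_dvd_Q : ~ mdvd (lin a) (prod_lin l).
Proof.
apply: dvd_Q_not_lin => // b bl ab.
case: sl => /andP[al _] _ /(_ a b); rewrite mem_head inE bl orbT.
by move=> /(_ isT isT ab) e; rewrite e bl in al.
Qed.

(** D(a :: l) lies in D(l), and multiplication by [lin a] sends D(l) back into D(a :: l). T and R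
    express these two inclusions in the bases. *)
Lemma transition : exists T R, [/\ Th = T *m eta, lin a *: eta = R *m Th,
  T *m R = (lin a)%:M & R *m T = (lin a)%:M].
Proof.
have [hD hH [c c0 dTh]] := hTh.
have bTh := hbasis_basis sl hTh.
have [T TE] : exists T, Th = T *m eta.
  apply: basis_mx heta _ => i; apply: inD_sub (hD i) => b bl.
  by rewrite inE bl orbT.
have [R RE] : exists R, lin a *: eta = R *m Th.
  apply: basis_mx bTh _ => i; rewrite linearZ /=; apply: inD_cons.
  by case: heta.
exists T, R; split=> //.
- apply: (basis_injmx bTh).
  by rewrite -mulmxA -RE -scalemxAr -TE mul_scalar_mx.
- by apply: (basis_injmx heta); rewrite -mulmxA -TE -RE mul_scalar_mx.
Qed.

(** At a point where the form a takes the value 1, T and R become inverse to each other. *)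
Lemma transition_size : m = n.
Proof.
have [T [R [_ _ TR RT]]] := transition.
pose x j := dualv a 0 j.
have eva : meval x (lin a) = 1.
  rewrite -(dot_dual a0) /lin raddf_sum; apply: eq_bigr => j _ /=.
  by rewrite mevalZ mevalXU.
apply/eqP; rewrite eqn_leq; apply/andP; split.
- apply: (@mulmx1_min _ _ _ (map_mx (meval x) R) (map_mx (meval x) T)).
  by rewrite -map_mxM RT map_scalar_mx /= eva.
- apply: (@mulmx1_min _ _ _ (map_mx (meval x) T) (map_mx (meval x) R)).
  by rewrite -map_mxM TR map_scalar_mx /= eva.
Qed.

End Transition.

(* Nakayama: if R vanished at 0, then deriving T R = lin a %:M would show that
   det T is invertible at 0, hence constant for degree reasons, so that
   D(a :: l) = D(l). *)
Lemma transition_neq0 a l d (Th T R eta : 'M[S]_n) :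
  distinct_lines (a :: l) -> hbasis (a :: l) d Th -> D_basis l eta ->
  Th = T *m eta -> T *m R = (lin a)%:M ->
  exists i j, (R i j)@_0%MM != 0.
Proof.
move=> sl hTh heta TE TR.
have a0 : a != 0 by case: sl => _ + _; apply; rewrite mem_head.
have sl' : distinct_lines l.
  have ul : uniq l by case: sl => /andP[].
  by apply: simple_sub sl ul _ => b bl; rewrite inE bl orbT.
have [hD hH [c c0 dTh]] := hTh.
have [w wE] := dvd_det sl' (proj1 heta).
have cE : c *: lin a = \det T * w.
  have := dTh; rewrite TE det_mulmx wE /prod_lin big_cons -/(prod_lin l) => e.
  apply: (mulfI (Q_neq0 sl')).
  by rewrite -scalerAr [prod_lin l * lin a]mulrC -e mulrCA.
case: (boolP [forall i, forall j, (R i j)@_0%MM == 0]) => [/forallP R0|]; last first.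
  by case/forallPn => i /forallPn[j h]; exists i, j.
have [j aj] : exists j, a 0 j != 0 by apply/rV0Pn.
have T0 : (\det T)@_0%MM != 0.
  have e : map_mx ev0 T *m map_mx (fun p => ev0 (mderiv j p)) R = (a 0 j)%:M.
    apply/matrixP => i k; have /matrixP/(_ i k)/(congr1 (fun p => ev0 (mderiv j p))) := TR.
    rewrite !mxE raddfMn /= mderiv_lin raddfMn /= mcoeffC eqxx mulr1 => <-.
    rewrite (linear_sum (mderiv j)) raddf_sum.
    apply: eq_bigr => r _; rewrite !mxE /= mderivM.
    by rewrite mcoeffD !rmorphM /= (eqP (forallP (R0 r) k)) mulr0 add0r.
  have := congr1 determinant e; rewrite det_mulmx det_scalar det_map_mx => d1.
  have : a 0 j ^+ n != 0 by rewrite expf_neq0.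
  by rewrite -d1 mulf_eq0 => /norP[].
have w0 : w@_0%MM = 0.
  have := congr1 ev0 cE; rewrite mcoeffZ mcoeff0_lin mulr0 rmorphM /= => /esym/eqP.
  by rewrite mulf_eq0 (negPf T0) => /eqP.
have ca : c *: lin a != 0 by rewrite scaler_eq0 negb_or c0 lin_eq0.
have wn0 : w != 0 by apply: contra_neq ca => w1; rewrite cE w1 mulr0.
have dn0 : \det T != 0 by apply: contra_neq ca => w1; rewrite cE w1 mul0r.
(* The product det T * w has degree 1, and w has positive degree because it is nonzero and vanishes
   at 0; so det T is constant. *)
have dT1 : (msize (\det T) <= 1)%N.
  have := msizeM dn0 wn0; rewrite -cE (msize_homog ca (rpredZ _ (lin_homog a))).
  have : (1 < msize w)%N.
    rewrite ltnNge; apply: contra wn0 => /msize1_polyC ->.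
    by rewrite w0 mpolyC0.
  case: (msize w) => [//|[//|s]] _; rewrite !addnS /= => -[].
  by case: (msize _) => [//|[//|r]]; rewrite addSn.
have dTE := msize1_polyC dT1; set t := (\det T)@_0%MM in T0 dTE.
have etaE : eta = ((t^-1)%:MP *: \adj T) *m Th.
  rewrite TE mulmxA -scalemxAl mul_adj_mx dTE scale_scalar_mx.
  by rewrite -mpolyCM mulVf // mpolyC1 mul1mx.
(* This field lies in D(l), but it sends [lin a] to Q(l), which [lin a] does not divide; so it is
   not in D(a :: l). *)
have hQ : inD l (\row_k (prod_lin l * (dualv a 0 k)%:MP)).
  move=> b bl; suff -> : der_lin (\row_k (prod_lin l * (dualv a 0 k)%:MP)) b
      = prod_lin l * (\sum_k b 0 k *: (dualv a 0 k)%:MP).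
    apply: dvdM; exists (prod_lin (rem b l)); rewrite /prod_lin.
    by rewrite (perm_big _ (perm_to_rem bl)) big_cons.
  by rewrite /der_lin mulr_sumr; apply: eq_bigr => k _; rewrite mxE scalerAr.
have [x [xE _]] := proj2 heta _ hQ.
have : inD (a :: l) (\row_k (prod_lin l * (dualv a 0 k)%:MP)).
  by rewrite xE etaE mulmxA; apply: inD_mul.
move/(_ a (mem_head _ _)); rewrite /der_lin.
under eq_bigr => k _ do rewrite mxE scalerAr -mul_mpolyC -mpolyCM.
rewrite -mulr_sumr -raddf_sum /= -/(dotv a _) dot_dual // mpolyC1 mulr1.
by move/(not_dvd_Q sl).
Qed.

(* Some entry R_ij has a nonzero constant term, and the degree d_j component of
   lin a *: eta_i = sum_k R_ik Th_k exhibits the new row. *)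
Lemma exchange a l d (Th : 'M[S]_n) m (eta : 'M[S]_(m, n)) :
  distinct_lines (a :: l) -> hbasis (a :: l) d Th -> D_basis l eta ->
  exists j e (phi : 'rV[S]_n), [/\ d j = e.+1, forall k, phi 0 k \is e.-homog,
    ~ inD (a :: l) phi &
    hbasis l (fun i => if i == j then e else d i) (rrow j phi Th)].
Proof.
move=> sl hTh heta; have mn := transition_size sl hTh heta.
move: eta heta; rewrite mn => eta heta.
have [T [R [TE RE TR RT]]] := transition sl hTh heta.
have [i [j Rij]] := transition_neq0 sl hTh heta TE TR.
have [hD hH [c c0 dTh]] := hTh.
have sl' : distinct_lines l.
  have ul : uniq l by case: sl => /andP[].
  by apply: simple_sub sl ul _ => b bl; rewrite inE bl orbT.
have a0 : a != 0 by case: sl => _ + _; apply; rewrite mem_head.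
(* The part of row i of R that contributes to degree d j; its entry at j is the nonzero constant
   term of R i j. *)
pose s : 'rV[S]_n := \row_r if (d r <= d j)%N
  then pihomog mdeg (d j - d r) (R i r) else 0.
have sj : s 0 j = ((R i j)@_0%MM)%:MP by rewrite mxE leqnn subnn pihomog0E.
have sE k : pihomog mdeg (d j) (lin a * eta i k) = (s *m Th) 0 k.
  have /matrixP/(_ i k) := RE; rewrite !mxE => ->; rewrite raddf_sum /=.
  apply: eq_bigr => r _; rewrite mxE (pihomogM _ _ (hH r k)).
  by case: ifP; rewrite ?mul0r.
have dTh0 : \det Th != 0 by rewrite dTh scaler_eq0 negb_or c0 Q_neq0.
(* Degree 0 is impossible: a multiple of [lin a] has no constant component, so s would vanish. *)
case dj : (d j) => [|e].
  have : s = 0.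
    apply: (mulmx_inj dTh0); rewrite mul0mx; apply/rowP => k.
    by rewrite -sE mulrC (pihomogM _ _ (lin_homog a)) dj mxE.
  move/rowP/(_ j)/eqP; rewrite sj mxE mpolyC_eq0.
  by rewrite (negPf Rij).
pose phi := pi_row e (row i eta).
have phiD : inD l phi by apply: inD_pi_row; case: heta.
have phiE : lin a *: phi = s *m Th.
  apply/rowP => k; rewrite -sE mulrC (pihomogM _ _ (lin_homog a)) dj /=.
  by rewrite !mxE subn1 /= mulrC.
have phiH k : phi 0 k \is e.-homog by rewrite mxE; exact: pihomogP.
exists j, e, phi; split=> //.
  (* Membership of phi would make s a multiple of [lin a], against its nonzero constant entry at
     j. *)
  move=> /(proj2 (hbasis_basis sl hTh))[x [xE _]].
  have : lin a *: x = s.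
    by apply: (mulmx_inj dTh0); rewrite -phiE xE scalemxAl.
  move/rowP/(_ j)/(congr1 ev0); rewrite sj !mxE rmorphM /= mcoeff0_lin mul0r.
  by rewrite mcoeffC eqxx mulr1 => /esym/eqP; rewrite (negPf Rij).
split.
- move=> r; rewrite row_rrow; case: ifP => // _.
  by apply: inD_sub (hD r) => b bl; rewrite inE bl orbT.
- by move=> r k; rewrite mxE; case: ifP.
(* By Cramer, [lin a] times the new determinant is s_j det Th, and det Th carries exactly one factor
   [lin a] more than Q(l). *)
- exists ((R i j)@_0%MM * c); first by rewrite mulf_neq0.
  have la0 : lin a != 0 by rewrite lin_eq0.
  apply: (mulfI la0); rewrite det_rrow.
  transitivity ((lin a *: phi *m \adj Th) 0 j).
    by rewrite -scalemxAl [RHS]mxE.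
  rewrite phiE -mulmxA mul_mx_adj mul_mx_scalar mxE sj dTh.
  rewrite /prod_lin big_cons -/(prod_lin l) -!mul_mpolyC mpolyCM; ring.
Qed.

End Exchange.

(** * Terao's polynomial and the bound on the restriction *)

Section Restriction.

Variables (K : fieldType) (n : nat).
Local Notation S := {mpoly K[n]}.
Implicit Types (p q g h : S) (a b r : 'rV[K]_n) (f : 'rV[S]_n) (l : seq 'rV[K]_n).

Lemma red_homog a d p : p \is d.-homog -> red_lin_at a p \is d.-homog.
Proof.
move=> hp; rewrite [p]mpolyE raddf_sum /= big_seq; apply: rpred_sum => m mp.
rewrite linearZ /=; apply: rpredZ; rewrite mpolyXE_id rmorph_prod /=.
rewrite -(dhomogP _ _ _ hp m mp) /= mdegE.
apply: dhomog_big => i; rewrite rmorphXn /=.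
have h1 : red_lin_at a 'X_i \is 1.-homog.
  by rewrite redX rpredB ?rpredZ ?lin_homog // dhomogX /= mdeg1.
by have := dhomogMn (m i) h1; rewrite mul1n.
Qed.

Lemma dvd_expr_prime b k g h : b != 0 -> ~ mdvd (lin b) g ->
  mdvd (lin b ^+ k) (g * h) -> mdvd (lin b ^+ k) h.
Proof.
move=> b0 gb; elim: k h => [|k IH] h; first by exists h; rewrite expr0 mul1r.
rewrite exprS => -[q qE]; have lb0 : lin b != 0 by rewrite lin_eq0.
have [//|[h' hE]] : mdvd (lin b) g \/ mdvd (lin b) h.
  by apply: lin_prime => //; exists (lin b ^+ k * q); rewrite mulrA.
have [h'' h'E] : mdvd (lin b ^+ k) h'.
  apply: IH; exists q; apply: (mulfI lb0).
  by rewrite mulrCA -hE qE mulrA.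
by exists h''; rewrite hE h'E mulrA.
Qed.

Variables (a : 'rV[K]_n) (l : seq 'rV[K]_n) (phi : 'rV[S]_n).
Hypotheses (sl : distinct_lines (a :: l)) (phiD : inD l phi).

Let a0 : a != 0.
Proof. by case: sl => _ + _; apply; rewrite mem_head. Qed.

Let f := red_lin_at a (der_lin phi a).
(** The restriction of the form b to the hyperplane of a, represented by the form congruent to b
    modulo a that kills [dualv a]. *)
Definition proj b := b - dotv b (dualv a) *: a.

Let projD x y b r : b = x *: a + y *: r -> proj b = y *: proj r.
Proof.
move=> ->; rewrite /proj scalerBr.
have -> : dotv (x *: a + y *: r) (dualv a) = x * dotv a (dualv a) + y * dotv r (dualv a).
  rewrite /dotv !mulr_sumr -big_split /=.
  by apply: eq_bigr => j _; rewrite !mxE; ring.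
by rewrite dot_dual // mulr1 scalerDl opprD addrACA subrr add0r scalerA.
Qed.

Let proj_neq0 b : b \in l -> proj b != 0.
Proof.
move=> bl; rewrite subr_eq0; apply/eqP => e.
have ab : parallel a b by exists (dotv b (dualv a)).
case: sl => /andP[al _] _ /(_ a b); rewrite mem_head inE bl orbT.
by move=> /(_ isT isT ab) e'; rewrite e' bl in al.
Qed.

(** For b and r in l, this says that they cut the hyperplane of a in the same subspace. *)
Definition same_class r b := exists x y, b = x *: a + y *: r.

Let proj_class c b r : proj b = c *: proj r -> same_class r b.
Proof.
move=> e; exists (dotv b (dualv a) - c * dotv r (dualv a)), c.
rewrite -[LHS](subrK (dotv b (dualv a) *: a)) -/(proj b) e.
by apply/rowP => j; rewrite !mxE; ring.
Qed.

(* All forms of the class of r divide lin a * phi(r) - lin r * phi(a), which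
   restricts to - lin r * phi(a) on the hyperplane a. *)
Lemma class_dvd l' r : {subset l' <= l} -> uniq l' -> r \in l ->
  (forall b, b \in l' -> same_class r b) ->
  mdvd (lin (proj r) ^+ size l') (f * lin (proj r)).
Proof.
move=> s u rl h.
pose P := lin a * der_lin phi r - lin r * der_lin phi a.
have PQ : mdvd (prod_lin l') P.
  apply: dvd_prod => [|b bl'].
    by apply: simple_sub sl u _ => b /s bl; rewrite inE bl orbT.
  have [x [y bE]] := h b bl'.
  have y0 : y != 0.
    apply/eqP => y0; have /proj_neq0 := s b bl'.
    by rewrite (projD bE) y0 scale0r eqxx.
  have [q qE] := phiD (s b bl').
  exists (y^-1 *: (lin a * q - der_lin phi a)).
  have lb : lin b = x *: lin a + y *: lin r by rewrite bE linearD !linearZ.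
  rewrite -scalerAr mulrBr mulrCA -qE {1}bE appDr !appZr lb /P.
  apply: (scalerI y0); rewrite scalerA mulfV // scale1r.
  by rewrite -!mul_mpolyC; ring.
have [q qE] := PQ; have := congr1 (red_lin_at a) qE.
rewrite /P rmorphB !rmorphM /= red_lin0 // mul0r sub0r red_lin -/(proj r) -/f.
move=> e.
have [c [c0 cE]] : exists c, c != 0 /\ red_lin_at a (prod_lin l') = c *: lin (proj r) ^+ size l'.
  move: s h {u PQ q qE e}; elim: l' => [|b k IH] s h.
    by exists 1; rewrite oner_eq0 /prod_lin big_nil rmorph1 scale1r expr0.
  have [||c [c0 cE]] := IH.
  - by move=> z zk; apply: s; rewrite inE zk orbT.
  - by move=> z zk; apply: h; rewrite inE zk orbT.
  have [x [y bE]] := h b (mem_head _ _).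
  have y0 : y != 0.
    apply/eqP => y0; have /proj_neq0 := s b (mem_head _ _).
    by rewrite (projD bE) y0 scale0r eqxx.
  exists (y * c); rewrite mulf_neq0 //; split=> //.
  rewrite /prod_lin big_cons -/(prod_lin k) rmorphM /= cE red_lin -/(proj b) (projD bE).
  by rewrite linearZ /= -scalerAr -scalerAl scalerA exprS [y * c]mulrC.
exists (- (c *: red_lin_at a q)).
apply: oppr_inj; rewrite mulrN opprK [f * _]mulrC e cE.
by rewrite -scalerAl -scalerAr.
Qed.

(** Terao's divisibility: the restriction of phi(a) contains each point's form to the power of its
    class size minus 1. The representatives stay on the right as a factor, and R may hold several
    from one class. *)
Lemma classes_dvd R l' : {subset l' <= l} -> uniq l' -> {subset R <= l} ->
  (forall b, b \in l' -> exists2 r, r \in R & same_class r b) ->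
  mdvd (\prod_(b <- l') lin (proj b)) (f * \prod_(r <- R) lin (proj r)).
Proof.
elim: R l' => [|r R IH] l' s u sR h.
  case: l' s u h => [|b l'] s u h; last by have [] := h b (mem_head _ _).
  by rewrite !big_nil; exists (f * 1); rewrite mul1r.
pose P b := proj b == dotv (proj b) (dualv (proj r)) *: proj r.
have rl : r \in l by apply: sR; rewrite mem_head.
have r0 := proj_neq0 rl.
have PP b : reflect (same_class r b) (P b).
  apply: (iffP eqP) => [/proj_class //|[x [y bE]]].
  rewrite (projD bE).
  have -> : dotv (y *: proj r) (dualv (proj r)) = y * dotv (proj r) (dualv (proj r)).
    by rewrite /dotv mulr_sumr; apply: eq_bigr => j _; rewrite !mxE mulrA.
  by rewrite dot_dual // mulr1.
have sl1 : {subset [seq b <- l' | ~~ P b] <= l}.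
  by move=> b; rewrite mem_filter => /andP[_ /s].
have [||b|t tE] := IH [seq b <- l' | ~~ P b] sl1.
- exact: filter_uniq.
- by move=> b bR; apply: sR; rewrite inE bR orbT.
- rewrite mem_filter => /andP[Pb bl'].
  have [r' + hr'] := h b bl'; rewrite inE => /orP[/eqP r'r|r'R]; last by exists r'.
  by case/PP: Pb; rewrite -r'r.
have H : mdvd (lin (proj r) ^+ size [seq b <- l' | P b]) (f * lin (proj r)).
  apply: class_dvd => //.
  - by move=> b; rewrite mem_filter => /andP[_ /s].
  - exact: filter_uniq.
  - by move=> b; rewrite mem_filter => /andP[/PP].
have lr0 : lin (proj r) != 0 by rewrite lin_eq0.
have prodE : \prod_(b <- l' | P b) lin (proj b) =
    (\prod_(b <- l' | P b) dotv (proj b) (dualv (proj r)))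
      *: lin (proj r) ^+ size [seq b <- l' | P b].
  elim: l' {h s u sl1 tE H} => [|b k IHk]; first by rewrite !big_nil scale1r expr0.
  rewrite !big_cons /=; case: ifP => // /eqP e.
  by rewrite IHk {1}e linearZ /= -scalerAr -scalerAl scalerA exprS mulrC.
have c0 : \prod_(b <- l' | P b) dotv (proj b) (dualv (proj r)) != 0.
  rewrite prodf_seq_neq0; apply/allP => b /s /proj_neq0 pb.
  by apply/implyP => /eqP e; apply: contra_neq pb => c0; rewrite e c0 scale0r.
have Gr : ~ mdvd (lin (proj r)) (\prod_(b <- l' | ~~ P b) lin (proj b)).
  rewrite -big_filter -(big_map proj predT (@lin K n)).
  apply: dvd_Q_not_lin => // _ /mapP[b + ->] [y yE].
  rewrite mem_filter => /andP[/negP]; case; apply/PP.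
  exact: proj_class yE.
rewrite big_cons mulrCA (bigID P) /= prodE; move: c0.
move: (\prod_(b <- l' | P b) dotv _ _) => c c0.
move: tE; rewrite big_filter; move: Gr.
set G := \prod_(b <- _ | ~~ _) _; set pR := \prod_(r <- R) _ => Gr tE.
suff [x xE] : mdvd (lin (proj r) ^+ size [seq b <- l' | P b] * G)
    (lin (proj r) * (f * pR)).
  exists (c^-1 *: x); rewrite xE.
  by rewrite -!scalerAl -scalerAr scalerA mulfV ?scale1r.
(* If the class of r has k + 1 members, the k-th power of its form divides f; being coprime to G, it
   divides the cofactor t. *)
move: H; case: (size _) => [_|k [q]].
  by exists (t * lin (proj r)); rewrite expr0 mul1r tE mulrC mulrA.
rewrite exprS mulrC -mulrA => /(mulfI lr0) fq.
have [t' t'E] : mdvd (lin (proj r) ^+ k) t.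
  apply: (@dvd_expr_prime (proj r) k G) => //.
  by exists (q * pR); rewrite -tE fq mulrA.
by exists t'; rewrite tE t'E; ring.
Qed.

(** Since phi is not tangent to a, the restriction of phi(a) is nonzero of degree e; degrees are
    compared in [classes_dvd]. With one representative per point this reads |A'| - |A''| <= e. *)
Lemma class_bound R e : {subset R <= l} ->
  (forall k, phi 0 k \is e.-homog) -> ~ inD (a :: l) phi ->
  (forall b, b \in l -> exists2 r, r \in R & same_class r b) ->
  (size l <= e + size R)%N.
Proof.
move=> sR hphi nD hR.
have f0 : f != 0.
  apply/eqP => /(dvd_lin _ a0) fa; apply: nD => b; rewrite inE => /orP[/eqP->//|].
  exact: phiD.
have ul : uniq l by case: sl => /andP[].
have [q qE] := classes_dvd (fun b => id) ul sR hR.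
have fh : f \is e.-homog.
  by apply: red_homog; apply: rpred_sum => j _; apply: rpredZ; exact: hphi.
have nz (s : seq 'rV[K]_n) : {subset s <= l} -> \prod_(b <- s) lin (proj b) != 0.
  move=> sl2; rewrite prodf_seq_neq0; apply/allP => b bs.
  by rewrite implyTb lin_eq0 proj_neq0 ?sl2.
have hh (s : seq 'rV[K]_n) : \prod_(b <- s) lin (proj b) \is (size s).-homog.
  rewrite -sum1_size; apply: (@dhomog_big _ _ _ s (fun=> 1%N)) => b.
  exact: lin_homog.
have p0 : f * \prod_(r <- R) lin (proj r) != 0 by rewrite mulf_neq0 ?nz.
have q0 : q != 0 by apply: contra_neq p0 => q0; rewrite qE q0 mulr0.
have := msizeM (nz l (fun b => id)) q0.
rewrite -qE (msize_homog p0 (dhomogM fh (hh R))).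
rewrite (msize_homog (nz l (fun b => id)) (hh l)) addSn /= => e1.
by rewrite -ltnS e1 -addn1 leq_add2l lt0n msize_poly_eq0.
Qed.

End Restriction.

(** * Derivations of the symmetric algebra as coefficient rows *)

Section DerivationRows.

Variables (K : fieldType) (n : nat).
Local Notation S := {mpoly K[n]}.
Implicit Types (p q : S) (f : 'rV[S]_n) (l : seq 'rV[K]_n).

Definition der f p : S := \sum_j f 0 j * p^`M(j).

Lemma der_is_linear f : linear (der f).
Proof.
move=> c p q; rewrite /der scaler_sumr -big_split /=; apply: eq_bigr => j _.
by rewrite linearP /= mulrDr scalerAr.
Qed.

HB.instance Definition _ f :=
  GRing.isLinear.Build K S S _ (der f) (der_is_linear f).

Lemma der_derivation f p q : der f (p * q) = der f p * q + p * der f q.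
Proof.
rewrite /der mulr_suml mulr_sumr -big_split /=; apply: eq_bigr => j _.
by rewrite mderivM; ring.
Qed.

Lemma derX f j : der f 'X_j = f 0 j.
Proof.
rewrite /der (bigD1 j) //= big1 ?addr0.
  have -> : 'X_j = lin (delta_mx 0 j) :> S.
    rewrite /lin (bigD1 j) //= mxE !eqxx scale1r big1 ?addr0 // => i /negPf ij.
    by rewrite mxE ij andbF scale0r.
  by rewrite mderiv_lin mxE !eqxx mpolyC1 mulr1.
move=> i /negPf ij; rewrite mderivX mnmE eq_sym ij scale0r mulr0.
by [].
Qed.

Definition coefs (theta : {linear S -> S}) : 'rV[S]_n := \row_j theta 'X_j.

Lemma theta_lin (theta : {linear S -> S}) a : theta (lin a) = der_lin (coefs theta) a.
Proof.
rewrite /lin linear_sum; apply: eq_bigr => j _.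
by rewrite linearZ mxE.
Qed.

Definition derivation (theta : {linear S -> S}) :=
  forall p q, theta (p * q) = theta p * q + p * theta q.

Lemma derivationE (theta : {linear S -> S}) p :
  derivation theta -> theta p = der (coefs theta) p.
Proof.
move=> hd; have h1 : theta 1 = 0.
  have := hd 1 1; rewrite !mulr1 mul1r -{1}[theta 1]addr0 => /addrI.
  by move->.
have d1 : der (coefs theta) 1 = 0.
  have := der_derivation (coefs theta) 1 1.
  by rewrite !mulr1 mul1r -{1}[der _ 1]addr0 => /addrI ->.
have hX j : theta 'X_j = der (coefs theta) 'X_j by rewrite derX mxE.
elim/mpolyind: p => [|c m p _ _ IH]; first by rewrite !linear0.
rewrite !linearD /= IH !linearZ /=; congr (_ *: _ + _).
rewrite mpolyXE_id.
elim/big_ind: _ => [|p1 p2 e1 e2|j _]; first by rewrite h1 d1.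
  by rewrite hd der_derivation e1 e2.
elim: (m j) => [|k IHk]; first by rewrite expr0 h1 d1.
by rewrite exprS hd der_derivation IHk hX.
Qed.

(** By Leibniz, theta(Q) is congruent to theta(alpha) Q/alpha modulo alpha, and alpha is coprime to
    Q/alpha. *)
Lemma theta_Q (theta : {linear S -> S}) l : distinct_lines l -> derivation theta ->
  (exists q, theta (prod_lin l) = prod_lin l * q) <-> inD l (coefs theta).
Proof.
move=> sl hd; split=> [[q qE] a al|h].
  have [_ l0 lp] := sl; have a0 := l0 _ al.
  have QE : prod_lin l = lin a * prod_lin (rem a l).
    by rewrite /prod_lin (perm_big _ (perm_to_rem al)) big_cons.
  rewrite -theta_lin.
  have : mdvd (lin a) (theta (lin a) * prod_lin (rem a l)).
    have e : theta (lin a) * prod_lin (rem a l) = prod_lin l * q - lin a * theta (prod_lin (rem a l)).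
      by rewrite -qE QE hd addrK.
    exists (prod_lin (rem a l) * q - theta (prod_lin (rem a l))).
    by rewrite e QE mulrBr mulrA.
  case/(lin_prime a0) => // /dvd_Q_not_lin -/(_ a0) [] b bl ab.
  have ul : uniq l by case: sl.
  move: bl; rewrite mem_rem_uniq // inE => /andP[/eqP ba bl].
  by apply: ba; rewrite (lp a b).
elim: l {sl} h => [|a l IH] h.
  exists 0; rewrite mulr0 /prod_lin big_nil.
  have := hd 1 1; rewrite !mulr1 mul1r -{1}[theta 1]addr0 => /addrI.
  by move->.
have [|q qE] := IH; first by move=> b bl; apply: h; rewrite inE bl orbT.
have [r rE] := h a (mem_head _ _).
exists (r + q); rewrite /prod_lin big_cons -/(prod_lin l) hd qE theta_lin rE.
by ring.
Qed.

Lemma inD_parallel l l' f :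
  (forall a, a \in l' -> exists2 b, b \in l & parallel b a) ->
  inD l f -> inD l' f.
Proof.
move=> h hf a /h[b bl [c ->]]; have [q qE] := hf b bl.
by exists q; rewrite appZr qE linearZ /= scalerAl.
Qed.

End DerivationRows.

(** * From arrangements of subspaces to lists of forms *)

Section Bridge.

Variables (K : fieldType) (V : vectType K).
Local Notation n := (\dim {:V}).
Local Notation S := {mpoly K[n]}.
Implicit Types (A : {fset {vspace V}}) (H : {vspace V}).

Definition row_of (f : 'Hom(V, K^o)) : 'rV[K]_n :=
  \row_j (f (vbasis {:V})`_j : K).

Lemma poly_of_formE f : poly_of_form f = lin (row_of f).
Proof. by apply: eq_bigr => j _; rewrite mxE. Qed.

Definition forms A := [seq row_of (linear_form H) | H <- A].

Lemma defining_polyE A : defining_poly A = prod_lin (forms A).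
Proof.
rewrite /prod_lin big_map; apply: eq_bigr => H _; exact: poly_of_formE.
Qed.

Lemma row_of_inj (f g : 'Hom(V, K^o)) (c : K) :
  row_of g = c *: row_of f -> forall v, g v = c *: f v.
Proof.
move=> e v; rewrite (coord_vbasis (memvf v)) !linear_sum /=.
apply: eq_bigr => j _; rewrite !linearZ /=.
have /rowP/(_ j) := e; rewrite !mxE => ->.
by rewrite /GRing.scale /=; ring.
Qed.

Lemma simple_forms A : is_arrangement A -> distinct_lines (forms A).
Proof.
move=> hA.
have ker H : H \in A -> lker (linear_form H) = H.
  by move=> HA; apply: lker_linear_form; apply: hA.
have memH H v : H \in A -> (v \in H) = (linear_form H v == 0).
  by move=> HA; rewrite -memv_ker (ker H HA).
have par H H' : H \in A -> H' \in A ->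
    parallel (row_of (linear_form H)) (row_of (linear_form H')) -> H = H'.
  move=> HA H'A [c /row_of_inj e].
  have sub : (H <= H')%VS.
    apply/subvP => v; rewrite (memH H v HA) (memH H' v H'A) (e v) => /eqP->.
    by rewrite scaler0.
  apply/eqP; rewrite eqEdim sub /= -ltnS.
  by rewrite (eqP (hA _ HA)) (eqP (hA _ H'A)).
split.
- rewrite map_inj_in_uniq ?fset_uniq // => H H' HA H'A e.
  by apply: (par H H' HA H'A); exists 1; rewrite scale1r e.
- move=> _ /mapP[H HA ->]; apply/eqP => e.
  have e0 : row_of (linear_form H) = 0 *: row_of (linear_form H).
    by rewrite scale0r.
  have := hA _ HA; rewrite /is_hyperplane -{1}(ker _ HA).
  have -> : lker (linear_form H) = fullv.
    apply/eqP; rewrite eqEsubv subvf /=; apply/subvP => v _.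
    by rewrite memv_ker (row_of_inj e0) scale0r.
  by rewrite eqn_leq ltnn.
- move=> _ _ /mapP[H HA ->] /mapP[H' H'A ->] /par.
  by move=> /(_ HA H'A) ->.
Qed.

Lemma in_DE A theta : is_arrangement A ->
  in_D A theta <-> derivation theta /\ inD (forms A) (coefs theta).
Proof.
move=> hA; rewrite /in_D defining_polyE.
by split=> -[hd /(theta_Q (simple_forms hA) hd)].
Qed.

Lemma coefs_der f : coefs (der f : {linear S -> S}) = f.
Proof. by apply/rowP => j; rewrite mxE /= derX. Qed.

Lemma is_D_basis_basis A m (th : 'I_m -> {linear S -> S}) :
  is_arrangement A -> is_D_basis A th ->
  D_basis (forms A) (\matrix_i coefs (th i)).
Proof.
move=> hA [hD hB]; split=> [i|f hf].
  by rewrite rowK; case/(in_DE _ hA): (hD i).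
have [|c [cE cu]] := hB (der f).
  by apply/in_DE => //; split; [exact: der_derivation|rewrite coefs_der].
exists c; split.
  apply/rowP => j; rewrite -derX cE mxE.
  by apply: eq_bigr => i _; rewrite !mxE.
move=> c' c'E; apply: cu => p.
have hd i : derivation (th i) by case/(in_DE _ hA): (hD i).
under [RHS]eq_bigr => i _ do rewrite (derivationE _ (hd i)) /der mulr_sumr.
rewrite exchange_big /=; apply: eq_bigr => j _.
rewrite c'E mxE mulr_suml; apply: eq_bigr => i _.
by rewrite !mxE mulrA.
Qed.

Lemma basis_is_D_basis A m (Th : 'M[S]_(m, n)) :
  is_arrangement A -> D_basis (forms A) Th ->
  is_D_basis A (fun i => der (row i Th) : {linear S -> S}).
Proof.
move=> hA [hD hB]; split=> [i|eta /(in_DE _ hA)[hd he]].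
  apply/in_DE => //; split; first exact: der_derivation.
  by rewrite coefs_der; exact: hD.
have [c [cE cu]] := hB _ he; exists c; split.
  move=> p; rewrite (derivationE _ hd) cE /der.
  under [RHS]eq_bigr => i _ do rewrite mulr_sumr.
  rewrite exchange_big /=; apply: eq_bigr => j _.
  by rewrite mxE mulr_suml; apply: eq_bigr => i _; rewrite !mxE mulrA.
move=> c' c'E; apply: cu; apply/rowP => j; rewrite !mxE c'E.
by apply: eq_bigr => i _; rewrite /= derX !mxE.
Qed.

Lemma is_freeP A : is_arrangement A ->
  is_free A <-> exists m (Th : 'M[S]_(m, n)), D_basis (forms A) Th.
Proof.
move=> hA; split=> [[_ [m [th /(is_D_basis_basis hA) h]]]|[m [Th h]]].
  by exists m; exists (\matrix_i coefs (th i)).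
by split=> //; exists m; exists (fun i => der (row i Th)); exact: basis_is_D_basis.
Qed.

End Bridge.

Lemma is_exp_free (K : fieldType) (V : vectType K) (A : {fset {vspace V}}) e :
  is_arrangement A -> is_exp A e -> is_free A.
Proof. by move=> hA [th [h _]]; split=> //; exists (size e), th. Qed.

(** * Hyperplanes of C^4 given by row vectors *)

Section Perp.

Variable C : numClosedFieldType.
Local Notation V := 'cV[C]_4.
Local Notation n := (\dim {:V}).
Implicit Types (v w : 'rV[C]_4) (x : V).

Lemma dimV : n = 4.
Proof. by rewrite dimvf. Qed.

Lemma memv_perp v x : (x \in perp v) = (v *m x == 0).
Proof. by rewrite memv_ker lfunE. Qed.

Lemma mulmx_neq0 v : v != 0 -> exists x, v *m x = 1%:M.
Proof.
move=> /rV0Pn[j vj]; exists ((v 0 j)^-1 *: delta_mx j 0).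
rewrite -scalemxAr -colE; apply/matrixP => i k; rewrite !ord1 !mxE mulVf //.
Qed.

Lemma perp_hyperplane v : v != 0 -> is_hyperplane (perp v).
Proof.
move=> /mulmx_neq0[x vx]; rewrite /is_hyperplane.
have := limg_ker_dim (linfun (mulmx v : V -> 'cV[C]_1)) fullv.
rewrite capfv -/(perp v) => <-.
suff -> : \dim (limg (linfun (mulmx v : V -> 'cV[C]_1))) = 1%N by rewrite addn1.
suff -> : limg (linfun (mulmx v : V -> 'cV[C]_1)) = fullv by rewrite dimvf.
apply/eqP; rewrite eqEsubv subvf /=; apply/subvP => y _.
apply/memv_imgP; exists (x *m y); rewrite ?memvf // lfunE /= mulmxA vx mul1mx.
by [].
Qed.

Lemma perp_parallel v w : v != 0 -> perp v = perp w -> parallel v w.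
Proof.
move=> /mulmx_neq0[x vx] e; exists ((w *m x) 0 0).
apply/rowP => j.
have : delta_mx j 0 - x *m (v *m delta_mx j 0) \in perp w.
  by rewrite -e memv_perp mulmxBr [v *m (x *m _)]mulmxA vx mul1mx subrr.
rewrite memv_perp mulmxBr [w *m (x *m _)]mulmxA -!colE subr_eq0 => /eqP/matrixP/(_ 0 0).
by rewrite !mxE big_ord1 !mxE => ->.
Qed.

Lemma parallel_perp v w (c : C) : c != 0 -> w = c *: v -> perp w = perp v.
Proof.
move=> c0 ->; apply/vspaceP => x; rewrite !memv_perp -scalemxAl.
by rewrite scaler_eq0 (negPf c0).
Qed.

(** The variables of S are coordinates in the unspecified basis [vbasis], whose vectors are the
    columns here; a row v becomes [v *m coordP] in them. *)
Definition coordP : 'M[C]_(4, n) := \matrix_(i, j) (vbasis {:V})`_j i 0.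

Lemma coordP_inv : exists P', coordP *m P' = 1%:M /\ P' *m coordP = 1%:M.
Proof.
pose cv x : 'cV[C]_n := \col_j coord (vbasis {:V}) j x.
have Pcv x : coordP *m cv x = x.
  rewrite [RHS](coord_vbasis (memvf x)); apply/colP => i; rewrite !mxE summxE.
  by apply: eq_bigr => j _; rewrite !mxE mulrC.
pose P' : 'M[C]_(n, 4) := \matrix_(i, j) cv (delta_mx j 0) i 0.
have P'E : coordP *m P' = 1%:M.
  apply/matrixP => i j; have /colP/(_ i) := Pcv (delta_mx j 0).
  rewrite !mxE eqxx andbT => <-; apply: eq_bigr => k _.
  by rewrite !mxE.
exists P'; split=> //; clear Pcv; clearbody P'; clear cv.
move: P' P'E; move: coordP.
by rewrite dimV => P P' /mulmx1C.
Qed.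

(** Two forms with the same kernel are proportional; the factor is the value at a vector x with v x
    = 1. *)
Lemma linear_form_perp v : v != 0 -> exists2 c : C, c != 0 &
  row_of (linear_form (perp v)) = c *: (v *m coordP).
Proof.
move=> v0; have [x vx] := mulmx_neq0 v0.
have hk := lker_linear_form (perp_hyperplane v0).
set g := linear_form _ in hk *.
have gE y : g y = (v *m y) 0 0 *: g x.
  have : y - (v *m y) 0 0 *: x \in perp v.
    rewrite memv_perp mulmxBr -scalemxAr vx subr_eq0; apply/eqP/matrixP => i j.
    by rewrite !ord1 !mxE mulr1.
  by rewrite -hk memv_ker linearB linearZ /= subr_eq0 => /eqP.
exists (g x).
  apply/eqP => gx; have : x \in perp v by rewrite -hk memv_ker gx.
  by rewrite memv_perp vx => /eqP/matrixP/(_ 0 0)/eqP; rewrite !mxE oner_eq0.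
apply/rowP => j; rewrite !mxE gE /GRing.scale /= mulrC; congr (_ * _).
by rewrite mxE; apply: eq_bigr => i _; rewrite mxE.
Qed.

End Perp.

(** * Power sums over root lines *)

Section Gaussian.

Variable C : numClosedFieldType.

Definition zc (z : Z) : C := (int_of_Z z)%:~R.
Definition gz (x : gint) : C := zc x.1 + 'i * zc x.2.

Lemma zcD a b : zc (Z.add a b) = zc a + zc b.
Proof. by rewrite /zc -intrD -[(Z.add a b)]/(a + b) raddfD. Qed.
Lemma zcM a b : zc (Z.mul a b) = zc a * zc b.
Proof. by rewrite /zc -intrM -[(Z.mul a b)]/(a * b) rmorphM. Qed.
Lemma zcN a : zc (Z.opp a) = - zc a.
Proof. by rewrite /zc -mulrNz -[(Z.opp a)]/(- a) raddfN. Qed.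
Lemma zcB a b : zc (Z.sub a b) = zc a - zc b.
Proof. by rewrite -zcN -zcD. Qed.

Lemma gzD x y : gz (gadd x y) = gz x + gz y.
Proof. by rewrite /gz /= !zcD; ring. Qed.
Lemma gzN x : gz (gopp x) = - gz x.
Proof. by rewrite /gz /= !zcN; ring. Qed.
Lemma gzM x y : gz (gmul x y) = gz x * gz y.
Proof.
rewrite /gz /= zcB zcD !zcM.
have i2 : 'i * 'i = -1 :> C by rewrite -expr2 sqrCi.
transitivity (zc x.1 * zc y.1 + ('i * 'i) * (zc x.2 * zc y.2)
   + 'i * (zc x.1 * zc y.2 + zc x.2 * zc y.1)); last by ring.
by rewrite i2; ring.
Qed.
Lemma gz0 : gz gzero = 0. Proof. by rewrite /gz /= mulr0 addr0. Qed.
Lemma gz1 : gz gone = 1. Proof. by rewrite /gz /= mulr0 addr0. Qed.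

Lemma gz2 : gz gtwo = 2%:R. Proof. by rewrite /gz /= mulr0 addr0. Qed.

(** Multiplying by the conjugate gives a sum of two integer squares equal to 0. *)
Lemma gz_eq0 x : gz x = 0 -> x = gzero.
Proof.
case: x => a b; rewrite /gz /= => e.
have i2 : 'i * 'i = -1 :> C by rewrite -expr2 sqrCi.
have : zc a ^+ 2 + zc b ^+ 2 = 0.
  transitivity ((zc a + 'i * zc b) * (zc a - 'i * zc b) + (1 + 'i * 'i) * zc b ^+ 2).
    by ring.
  by rewrite e i2 subrr !mul0r addr0.
rewrite /zc !expr2 -!intrM -intrD => /eqP; rewrite intr_eq0.
rewrite paddr_eq0 -?expr2 ?sqr_ge0 // !expf_eq0 /= => /andP[/eqP a0 /eqP b0].
by rewrite /gzero -[a]int_of_ZK a0 -[b]int_of_ZK b0.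
Qed.

Lemma geqbP x y : reflect (x = y) (geqb x y).
Proof.
apply: (iffP andP) => [[/Z.eqb_spec e1 /Z.eqb_spec e2]|->].
  by case: x y e1 e2 => a b [c d] /= -> ->.
by split; apply/Z.eqb_spec.
Qed.

Lemma gz_neq0 x : ~~ geqb x gzero -> gz x != 0.
Proof. by apply: contra => /eqP/gz_eq0 ->; apply/geqbP. Qed.

Lemma gz_sum (s : seq gint) : gz (gsum s) = \sum_(x <- s) gz x.
Proof.
by elim: s => [|x s IH]; rewrite ?big_nil ?gz0 // big_cons gzD IH.
Qed.

Lemma gz_sum4 (F : nat -> gint) :
  gz (gsum [seq F j | j <- iota 0 4]) = \sum_(j < 4) gz (F j).
Proof.
rewrite gz_sum big_map -(big_mkord predT (fun j => gz (F j))).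
by rewrite /index_iota subn0.
Qed.

Lemma gz_pow x k : gz (gpow x k) = gz x ^+ k.
Proof.
elim: k => [|k IH]; first by rewrite gz1 expr0.
by rewrite exprS -IH -gzM.
Qed.

Definition gv (v : seq gint) : 'rV[C]_4 := \row_j gz (ent v j).
Definition gc (v : seq gint) : 'cV[C]_4 := \col_j gz (ent v j).

Lemma gdotE u v : gv u *m gc v = (gz (gdot u v))%:M.
Proof.
apply/matrixP => i j; rewrite !ord1 !mxE mulr1n /gdot gz_sum4.
by apply: eq_bigr => k _; rewrite !mxE gzM.
Qed.

Lemma mem_ord4 (j : 'I_4) : (j : nat) \in iota 0 4.
Proof. by rewrite mem_iota add0n ltn_ord. Qed.

Lemma indep_not_parallel u v : indep u v -> ~ parallel (gv u) (gv v).
Proof.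
move=> /hasP[[i j]]; rewrite !inE => ij /gz_neq0 m0 [c /rowP e].
have [i4 j4] : (i < 4)%N /\ (j < 4)%N.
  by move: ij; rewrite !xpair_eqE => /or3P[|| /or4P[]] /andP[/eqP-> /eqP->].
have := e (Ordinal i4); have := e (Ordinal j4); rewrite !mxE /= => ej ei.
case/eqP: m0; rewrite /minor /= gzD gzN !gzM ei ej.
by ring.
Qed.

Lemma indep_neq0 u v : indep u v -> gv v != 0.
Proof.
move=> h; apply/eqP => v0; apply: (indep_not_parallel h).
by exists 0; rewrite v0 scale0r.
Qed.

Lemma dep_span u v w : dep u v w -> exists x y, gv w = x *: gv u + y *: gv v.
Proof.
move=> /hasP[[i j] _ /andP[/gz_neq0 m0 /allP h]].
set D := minor u v (i, j) in m0 h.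
exists (gz (minor w v (i, j)) / gz D), (gz (minor u w (i, j)) / gz D).
apply/rowP => k; rewrite !mxE; apply: (mulfI m0).
have /geqbP/(congr1 gz) := h k (mem_ord4 k); rewrite gzD !gzM => ->.
by field.
Qed.

End Gaussian.

Section RootRows.

Variables (C : numClosedFieldType) (n : nat) (P : 'M[C]_(4, n)) (P' : 'M[C]_(n, 4)).
Hypothesis PP' : P *m P' = 1%:M.
Local Notation S := {mpoly C[n]}.

Definition row_at (k : nat) : 'rV[C]_n := gv C (rt k) *m P.
Definition rows (s : seq nat) : seq 'rV[C]_n := [seq row_at k | k <- s].

Lemma rowsP s a : a \in rows s -> exists2 k, k \in s & a = row_at k.
Proof. by rewrite /rows => /mapP. Qed.

Lemma mem_rows s k : k \in s -> row_at k \in rows s.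
Proof. exact: map_f. Qed.

Lemma size_rows s : size (rows s) = size s.
Proof. exact: size_map. Qed.

Lemma row_at_parallel h k : h \in all60 -> k \in all60 ->
  parallel (row_at h) (row_at k) -> h = k.
Proof.
move=> h60 k60 [c e].
have /orP[/eqP//|/(@indep_not_parallel C)] := allP (allP indep_roots _ h60) _ k60.
case; exists c; have := congr1 (mulmx^~ P') e.
by rewrite -!scalemxAl -!mulmxA PP' !mulmx1.
Qed.

Lemma gv_rt_neq0 k : k \in all60 -> gv C (rt k) != 0.
Proof.
move=> k60; pose h := if k == 0%N then 1%N else 0%N.
have h60 : h \in all60 by rewrite /h; case: ifP.
have /orP[|/(@indep_neq0 C)//] := allP (allP indep_roots _ h60) _ k60.
by rewrite /h; case: (k =P 0%N) => [->|nk /eqP e] //; case: nk.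
Qed.

Lemma row_at_neq0 k : k \in all60 -> row_at k != 0.
Proof.
move=> /gv_rt_neq0; apply: contra_neq => /(congr1 (mulmx^~ P')).
by rewrite -mulmxA PP' mulmx1 mul0mx.
Qed.

Lemma row_at_inj : {in all60 &, injective row_at}.
Proof.
by move=> h k h60 k60 e; apply: row_at_parallel => //; exists 1; rewrite scale1r.
Qed.

Lemma simple_rows s : uniq s -> {subset s <= all60} -> distinct_lines (rows s).
Proof.
move=> us s60; split.
- by rewrite map_inj_in_uniq // => h k /s60 h60 /s60 k60; exact: row_at_inj.
- by move=> _ /mapP[k /s60 k60 ->]; exact: row_at_neq0.
- move=> _ _ /mapP[h /s60 h60 ->] /mapP[k /s60 k60 ->] hk.
  by congr row_at; exact: row_at_parallel.
Qed.

Lemma dep_class h k k' : dep (rt h) (rt k') (rt k) ->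
  same_class (row_at h) (row_at k') (row_at k).
Proof.
move=> /(@dep_span C)[x [y e]]; exists x, y.
by rewrite /row_at e mulmxDl -!scalemxAl.
Qed.

(** The constant vector field u of C^4, written in the coordinates of S. *)
Definition cst (u : 'cV[C]_4) : 'rV[S]_n := map_mx (@mpolyC n C) (P' *m u)^T.

Lemma app_cst u (w : 'rV[C]_4) : der_lin (cst u) (w *m P) = ((w *m u) 0 0)%:MP.
Proof.
rewrite -[w *m u]mulmx1 -[w in RHS]mulmx1 -PP' mulmx1 -!mulmxA mulmxA.
rewrite [in RHS]mxE raddf_sum; apply: eq_bigr => j _.
by rewrite !mxE -mul_mpolyC -mpolyCM.
Qed.

(** For p = 1 mod 4, replacing a root v by a fourth root of unity times v does not change its
    term. *)
Definition psf (s : seq nat) (p : nat) : 'rV[S]_n :=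
  \sum_(k <- s) lin (row_at k) ^+ p *: cst (gc C (vconj (rt k))).

Lemma app_psf s p h : der_lin (psf s p) (row_at h) =
  \sum_(k <- s) gz C (gdot (rt h) (vconj (rt k))) *: lin (row_at k) ^+ p.
Proof.
rewrite /psf; elim: s => [|k s IH].
  by rewrite !big_nil -(scale0r 0) appZl mul0r.
rewrite !big_cons appDl IH appZl app_cst gdotE mxE mulr1n.
by rewrite mulrC mul_mpolyC.
Qed.

(* The reflection at h permutes the terms of the power sum up to units; it fixes
   the hyperplane h pointwise and negates alpha_h, so the terms cancel modulo
   alpha_h. *)
Lemma psf_inD s p h : h \in all60 -> {subset s <= all60} -> stable h s ->
  mdvd (lin (row_at h)) (der_lin (psf s (4 * p).+1) (row_at h)).
Proof.
move=> h60 s60 st; have a0 := row_at_neq0 h60; apply/dvd_lin => //.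
rewrite app_psf rmorph_sum /=.
pose t k := red_lin_at (row_at h) (gz C (gdot (rt h) (vconj (rt k))) *: lin (row_at k) ^+ (4 * p).+1).
have tE k : t k = gz C (gdot (rt h) (vconj (rt k)))
    *: red_lin_at (row_at h) (lin (row_at k)) ^+ (4 * p).+1.
  by rewrite /t linearZ rmorphXn.
have tt k : k \in s -> t (tau h k) = - t k.
  move=> ks; have /hasP[u uu] := allP (allP tau_refl _ h60) _ (s60 _ ks).
  move: (tau h k) => k' /andP[/geqbP/(congr1 (gz C)) e1 /allP e2].
  rewrite gzM gzN in e1.
  have u4 : gz C u ^+ 4 = 1.
    rewrite -gz_pow; move: uu; rewrite !inE.
    by move=> /or4P[] /eqP ->; rewrite -[gpow _ _]/gone gz1.
  have e : red_lin_at (row_at h) (lin (row_at k')) = gz C u *: red_lin_at (row_at h) (lin (row_at k)).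
    have n2 : 2%:R != 0 :> C by rewrite pnatr_eq0.
    set sc := gdot (rt k) (vconj (rt h)) in e2.
    have E : 2%:R *: row_at k' = gz C u *: (2%:R *: row_at k - gz C sc *: row_at h).
      rewrite /row_at !scalemxAl -mulmxBl scalemxAl; congr (_ *m _).
      apply/rowP => j; have /geqbP/(congr1 (gz C)) := e2 j (mem_ord4 j).
      by rewrite !gzM gzD gzN !gzM gz2 !mxE.
    have := congr1 (fun v => red_lin_at (row_at h) (lin v)) E.
    rewrite /= !(linearZ, linearB) /= red_lin0 // oppr0 scaler0 addr0.
    by rewrite scalerA mulrC -scalerA; exact: scalerI.
  rewrite !tE e exprZn scalerA -scaleNr -e1.
  by congr (_ *: _); rewrite exprS exprM u4 expr1n mulr1 mulrC.
(* Reindexing by the permutation [tau h] turns the sum into its negative, and 2 is invertible. *)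
have : \sum_(k <- s) t k = - \sum_(k <- s) t k.
  rewrite -sumrN -(perm_big _ st) big_map big_seq [RHS]big_seq.
  exact: eq_bigr.
move=> /eqP; rewrite -addr_eq0 -mulr2n -scaler_nat scaler_eq0 pnatr_eq0 /=.
by move=> /eqP.
Qed.

Lemma psf_homog s p j : psf s p 0 j \is p.-homog.
Proof.
rewrite /psf summxE; apply: rpred_sum => k _; rewrite !mxE mulrC mul_mpolyC.
apply: rpredZ.
by have := dhomogMn p (lin_homog (row_at k)); rewrite mul1n.
Qed.

End RootRows.

Lemma ent_map (F : nat -> gint) (k : 'I_4) : ent [seq F j | j <- iota 0 4] k = F k.
Proof. by rewrite /ent (nth_map 0%N) ?size_iota // nth_iota. Qed.

(** * A homogeneous basis after removing part of a star *)

Section StarBasis4.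

Variables (C : numClosedFieldType) (P P' : 'M[C]_4).
Hypotheses (PP' : P *m P' = 1%:M) (P'P : P' *m P = 1%:M).
Local Notation S := {mpoly C[4]}.
Variables (s M : seq nat).
Hypotheses (hs : s \in stars) (uM : uniq M) (Ms : {subset M <= s}).

Let s_ok := allP stars_ok _ hs.
Let s60 : {subset s <= all60}.
Proof. by case/and3P: s_ok => _ _ /allP. Qed.

(** The degrees 1, 9, 13, 17 add up to 40, the number of hyperplanes outside the star. *)
Definition base_fields : seq 'rV[S]_4 :=
  [:: \row_j 'X_j; psf P P' s 9; psf P P' all60 13; psf P P' all60 17].

Definition base_mx : 'M[S]_4 := \matrix_i nth 0 base_fields i.

Definition rest_poly : S := prod_lin (rows P [seq k <- s | k \notin M]).

Definition star_mx : 'M[S]_4 :=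
  rrow (Ordinal (erefl (1 < 4)%N)) (rest_poly *: psf P P' s 9) base_mx.

(** 29 - |M| is 9 plus the 20 - |M| forms of the star that are kept. *)
Definition star_deg (i : 'I_4) : nat := nth 0%N [:: 1; 29 - size M; 13; 17]%N i.

Let y j : C := (P' *m gc C pt) j 0.

Let meval_lin a : meval y (lin a) = (a *m (P' *m gc C pt)) 0 0.
Proof.
rewrite /lin raddf_sum mxE; apply: eq_bigr => j _ /=.
by rewrite mevalZ mevalXU.
Qed.

Let meval_row k : meval y (lin (row_at P k)) = gz C (gdot (rt k) pt).
Proof. by rewrite meval_lin -mulmxA [P *m _]mulmxA PP' mul1mx gdotE mxE mulr1n. Qed.

Let meval_psf t p j : meval y (psf P P' t p 0 j) =
  \sum_(i < 4) gz C (field_at t p i) * P' j i.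
Proof.
rewrite /psf summxE raddf_sum /=.
transitivity (\sum_(k <- t) \sum_(i < 4)
   gz C (gmul (gpow (gdot (rt k) pt) p) (ent (vconj (rt k)) i)) * P' j i).
  apply: eq_bigr => k _; rewrite !mxE mevalM rmorphXn /= meval_row mevalC mulr_sumr.
  by apply: eq_bigr => i _; rewrite !mxE gzM gz_pow mulrCA mulrC.
rewrite exchange_big; apply: eq_bigr => i _ /=.
by rewrite -mulr_suml /field_at gz_sum big_map.
Qed.

(** At [pt] the matrix becomes the numerical one times an invertible change of coordinates;
    [num_nonsing] certifies the former. *)
Lemma det_base_mx : \det base_mx != 0.
Proof.
suff : \det (map_mx (meval y) base_mx) != 0.
  by rewrite det_map_mx; apply: contra_neq => ->; rewrite rmorph0.
pose N : 'M[C]_4 := \matrix_(i, j) gz C (ent (nth [::] (num_rows s) i) j).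
have -> : map_mx (meval y) base_mx = N *m P'^T.
  apply/matrixP => i j; rewrite !mxE.
  case: i => -[|[|[|[|//]]]] i4 /=.
  - rewrite mxE mevalXU /y mxE; apply: eq_bigr => k _; rewrite !mxE mulrC.
    by [].
  - rewrite meval_psf; apply: eq_bigr => k _; rewrite !mxE.
    by rewrite -[nth _ _ _]/[seq field_at s 9 j | j <- iota 0 4] ent_map.
  - rewrite meval_psf; apply: eq_bigr => k _; rewrite !mxE.
    by rewrite -[nth _ _ _]/[seq field_at all60 13 j | j <- iota 0 4] ent_map.
  - rewrite meval_psf; apply: eq_bigr => k _; rewrite !mxE.
    by rewrite -[nth _ _ _]/[seq field_at all60 17 j | j <- iota 0 4] ent_map.
rewrite det_mulmx det_tr mulf_neq0 //; last first.
  have := congr1 determinant PP'; rewrite det_mulmx det1 => e.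
  by apply/eqP => e0; move: e; rewrite e0 mulr0 => /esym/eqP; rewrite oner_eq0.
have := allP num_nonsing _ hs; rewrite /nonsing => /andP[d0 /allP h].
set B := adj4 _ in d0 h; set d := mul4 _ _ _ _ in d0 h.
pose B' : 'M[C]_4 := \matrix_(i, j) gz C (ent (nth [::] B i) j).
have BN : B' *m N = (gz C d)%:M.
  apply/matrixP => i j.
  have /allP/(_ j (mem_ord4 j))/geqbP/(congr1 (gz C)) := h i (mem_ord4 i).
  rewrite /mul4 gz_sum4 !mxE => e.
  transitivity (gz C (if (i : nat) == j then d else gzero)).
    by rewrite -e; apply: eq_bigr => k _; rewrite !mxE gzM.
  by rewrite -val_eqE; case: eqP => _; rewrite ?gz0.
have := congr1 determinant BN; rewrite det_mulmx det_scalar => e.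
apply/eqP => N0; move: e; rewrite N0 mulr0 => /esym/eqP.
by rewrite expf_eq0 /= (negPf (gz_neq0 C d0)).
Qed.

(** The factor [rest_poly] makes the field of degree 9 tangent to the kept part of the star as well.
    The degrees then sum to 60 - |M|, so [hbasis_deg] applies. *)
Lemma star_hbasis4 : hbasis (rows P (comp M)) star_deg star_mx.
Proof.
have [us /eqP ss _] := and3P s_ok.
have M60 : {subset M <= all60} by move=> k /Ms /s60.
have sD : (size [seq k <- s | k \notin M] + size M = 20)%N.
  by rewrite size_diff.
have sM : (size M <= 20)%N by rewrite -sD leq_addl.
have sRp : distinct_lines (rows P [seq k <- s | k \notin M]).
  apply: (simple_rows PP'); first exact: filter_uniq.
  by move=> k; rewrite mem_filter => /andP[_ /s60].
apply: hbasis_deg.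
- exact: (simple_rows PP' (comp_uniq M) (@comp_sub M)).
- move=> i; rewrite /star_mx row_rrow.
  case: (i =P _) => [_|/eqP ni].
    move=> a /rowsP[h hc ->]; move: hc.
    rewrite mem_comp => /andP[hM h60]; rewrite appZl.
    case hs' : (h \in s).
      apply: dvdM; exists (prod_lin (rem (row_at P h) (rows P [seq k <- s | k \notin M]))).
      have hr : row_at P h \in rows P [seq k <- s | k \notin M].
        by apply: map_f; rewrite mem_filter hM.
      by rewrite /rest_poly /prod_lin (perm_big _ (perm_to_rem hr)) big_cons.
    rewrite mulrC; apply: dvdM; apply: (psf_inD PP' 2) => //.
    by have := allP (allP stable_star _ hs) _ h60; rewrite hs'.
  move=> a /rowsP[h /comp_sub h60 ->]; rewrite rowK; have st := allP stable_all _ h60.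
  case: i ni => -[|[|[|[|//]]]] i4 //= _.
  - exists 1; rewrite mulr1 /der_lin /lin; apply: eq_bigr => j _.
    by congr (_ *: _); rewrite mxE.
  - exact: (psf_inD PP' 3).
  - exact: (psf_inD PP' 4).
- move=> i k; rewrite /star_mx mxE; case: (i =P _) => [->|/eqP ni].
    rewrite mxE /star_deg /=.
    have -> : (29 - size M = size [seq k <- s | k \notin M] + 9)%N by lia.
    apply: dhomogM; last exact: psf_homog.
    by have := Q_homog (rows P [seq k <- s | k \notin M]); rewrite size_map.
  rewrite mxE; case: i ni => -[|[|[|[|//]]]] i4 //= _; try exact: psf_homog.
  by rewrite mxE dhomogX /= mdeg1.
- rewrite det_rrow -scalemxAl mxE -det_rrow.
  have -> : rrow (Ordinal (erefl (1 < 4)%N)) (psf P P' s 9) base_mx = base_mx.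
    apply/matrixP => i k; rewrite mxE; case: eqP => [->|//].
    by rewrite mxE.
  by rewrite mulf_neq0 ?det_base_mx // Q_neq0.
- rewrite !big_ord_recl big_ord0 /star_deg /= size_map.
  have := size_comp uM M60; move: sM.
  by move: (size M) (size (comp M)) => x z; lia.
Qed.

End StarBasis4.

(** The invertible P forces n = 4, which gives access to the explicit matrices. For later use only
    one degree is kept exactly, the others by the bound 17. *)
Lemma star_hbasis (C : numClosedFieldType) n (P : 'M[C]_(4, n)) (P' : 'M[C]_(n, 4)) s M :
  P *m P' = 1%:M -> P' *m P = 1%:M -> s \in stars -> uniq M -> {subset M <= s} ->
  exists d Th, hbasis (rows P (comp M)) d Th /\
    exists j, d j = (29 - size M)%N /\ forall i, i != j -> (d i <= 17)%N.
Proof.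
move=> PP' P'P hs uM Ms; have n4 : n = 4.
  by apply/eqP; rewrite eqn_leq (mulmx1_min P'P) (mulmx1_min PP').
move: P P' PP' P'P; rewrite n4 => P P' PP' P'P.
exists (star_deg M), (star_mx P P' s M); split; first exact: star_hbasis4.
exists (Ordinal (erefl (1 < 4)%N)); split=> // i.
by case: i => -[|[|[|[|//]]]].
Qed.

(** * Free filtrations *)

Section Perm.

Variables (K : fieldType) (n : nat).
Local Notation S := {mpoly K[n]}.
Implicit Types (l : seq 'rV[K]_n).

Lemma inD_perm l l' f : perm_eq l l' -> inD l f -> inD l' f.
Proof. by move=> /perm_mem pll h a; rewrite -pll; exact: h. Qed.

Lemma hbasis_perm l l' d M : perm_eq l l' -> hbasis l d M -> hbasis l' d M.
Proof.
move=> pll [hD hH [c c0 dM]]; split=> // [i|]; first exact: inD_perm (hD i).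
by exists c => //; rewrite dM /prod_lin (perm_big _ pll).
Qed.

End Perm.

Lemma FlP h k f : h \in all60 -> f \in Fl h -> k \in f ->
  [/\ k \in all60, k != h & forall k', k' \in f -> dep (rt h) (rt k) (rt k')].
Proof.
move=> h60 fF kf; have /and4P[/allP/(_ f fF)/allP/(_ k kf)] := allP flats_okP _ h60.
by case/and3P=> k60 kh /allP.
Qed.

Lemma Fl_cover h k : h \in all60 -> k \in all60 -> k != h ->
  exists2 f, f \in Fl h & k \in f.
Proof.
move=> h60 k60 kh; have /and4P[_ /allP/(_ k k60)] := allP flats_okP _ h60.
by rewrite (negPf kh) => /hasP[f fF kf] _ _; exists f.
Qed.

Lemma size_Fl h : h \in all60 -> size (Fl h) = 31.
Proof. by move=> /(allP flats_okP)/and4P[_ _ /eqP]. Qed.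

Lemma Fl_sym h k f : h \in all60 -> f \in Fl h -> k \in f ->
  exists2 f', f' \in Fl k & {subset f' <= h :: f}.
Proof.
move=> h60 fF kf; have /and4P[_ _ _ /allP/(_ f fF)/allP/(_ k kf)] := allP flats_okP _ h60.
by case/hasP=> f' fF' /allP sub; exists f'.
Qed.

(* One hyperplane outside s through each point of the restriction to h that
   survives the removal of s. *)
Definition reps (s : seq nat) (h : nat) : seq nat :=
  [seq nth 0%N f (find (fun k => k \notin s) f)
    | f <- Fl h & has (fun k => k \notin s) f].

Lemma repsP s h r : r \in reps s h -> exists2 f, f \in Fl h & (r \in f) && (r \notin s).
Proof.
move=> /mapP[f]; rewrite mem_filter => /andP[hf fF] ->; exists f => //.
by rewrite mem_nth -?has_find //=; exact: (nth_find 0%N hf).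
Qed.

Lemma reps_cover s h k : h \in all60 -> k \in all60 -> k != h -> k \notin s ->
  exists2 r, r \in reps s h & dep (rt h) (rt r) (rt k).
Proof.
move=> h60 k60 kh ks; have [f fF kf] := Fl_cover h60 k60 kh.
have hf : has (fun k => k \notin s) f by apply/hasP; exists k.
exists (nth 0%N f (find (fun k => k \notin s) f)).
  by apply/mapP; exists f => //; rewrite mem_filter hf.
have rf : nth 0%N f (find (fun k => k \notin s) f) \in f.
  by rewrite mem_nth // -has_find.
by have [_ _] := FlP h60 fF rf; exact.
Qed.

Lemma size_reps s h : h \in all60 -> (size (reps s h) + lost s h = 31)%N.
Proof.
move=> h60; rewrite size_map size_filter -[RHS](size_Fl h60) -(count_predC (fun f => has (fun k => k \notin s) f)).
congr (_ + _)%N; apply: eq_count => f /=.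
by rewrite -all_predC; apply: eq_all => k; rewrite /= negbK.
Qed.

Section Chain.

Variables (C : numClosedFieldType) (n : nat) (P : 'M[C]_(4, n)) (P' : 'M[C]_(n, 4)).
Hypotheses (PP' : P *m P' = 1%:M) (P'P : P' *m P = 1%:M).
Local Notation S := {mpoly C[n]}.

Definition freeM (M : seq nat) : Prop :=
  exists m (eta : 'M[S]_(m, n)), D_basis (rows P (comp M)) eta.

(** The head of M is the hyperplane removed last, so the nonempty tails are the earlier stages. *)
Fixpoint free_chain (M : seq nat) : Prop :=
  if M is h :: M' then freeM M /\ free_chain M' else True.

Lemma comp_cons h M : h \in all60 -> h \notin M ->
  perm_eq (comp M) (h :: comp (h :: M)).
Proof.
move=> h60 hM; apply: uniq_perm.
- exact: comp_uniq.
- by rewrite cons_uniq comp_uniq mem_comp inE eqxx.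
- move=> k; rewrite inE !mem_comp inE negb_or.
  by case: (k =P h) => [->|_]; rewrite ?hM ?h60.
Qed.

(** [exchange] and [class_bound] in terms of indices. The representatives R stay arbitrary, as the
    later arguments choose them differently. *)
Lemma exchange_step h M d Th : h \in all60 -> h \notin M ->
  hbasis (rows P (comp M)) d Th -> freeM (h :: M) ->
  exists j e d' Th', [/\ d j = e.+1, hbasis (rows P (comp (h :: M))) d' Th',
    d' j = e /\ (forall i, i != j -> d' i = d i) &
    forall R, {subset R <= comp (h :: M)} ->
      (forall k, k \in comp (h :: M) -> exists2 r, r \in R & dep (rt h) (rt r) (rt k)) ->
      (size (comp (h :: M)) <= e + size R)%N].
Proof.
move=> h60 hM hTh [m [eta heta]].
have pl : perm_eq (rows P (comp M)) (row_at P h :: rows P (comp (h :: M))).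
  exact: (perm_map (row_at P) (comp_cons h60 hM)).
have sl : distinct_lines (row_at P h :: rows P (comp (h :: M))).
  apply: (@simple_sub _ _ (rows P (comp M))).
  - exact: (simple_rows PP' (comp_uniq _) (@comp_sub _)).
  - rewrite -(perm_uniq pl).
    by case: (simple_rows PP' (comp_uniq M) (@comp_sub M)).
  - by move=> a; rewrite (perm_mem pl).
have [j [e [phi [dj hphi nD hb]]]] := exchange sl (hbasis_perm pl hTh) heta.
exists j, e; exists (fun i => if i == j then e else d i), (rrow j phi Th).
split=> //; first by split=> [|i /negPf ->]; rewrite ?eqxx.
move=> R sR hR.
have phiD : inD (rows P (comp (h :: M))) phi.
  by case: hb => hD _ _; have := hD j; rewrite row_rrow eqxx.
rewrite -(size_rows P (comp (h :: M))) -(size_rows P R).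
apply: (class_bound sl phiD _ hphi nD) => a /rowsP[k kC ->].
  by apply: mem_rows; exact: sR.
have [r rR hr] := hR k kC; exists (row_at P r); first exact: mem_rows.
exact: dep_class.
Qed.

(** There remain 59 - |M| hyperplanes and 31 - [lost M h] points on h. *)
Lemma lost_bound h M e : uniq (h :: M) -> {subset h :: M <= all60} ->
  (forall R, {subset R <= comp (h :: M)} ->
    (forall k, k \in comp (h :: M) -> exists2 r, r \in R & dep (rt h) (rt r) (rt k)) ->
    (size (comp (h :: M)) <= e + size R)%N) ->
  (28 + lost M h <= e + size M)%N.
Proof.
move=> uM M60 hR; have h60 : h \in all60 by rewrite M60 ?mem_head.
have sR : {subset reps M h <= comp (h :: M)}.
  move=> r /repsP[f fF /andP[rf rM]]; have [r60 rh _] := FlP h60 fF rf.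
  by rewrite mem_comp inE negb_or rh rM.
have := hR _ sR; have := size_reps M h60; have := size_comp uM M60.
move: (size (comp _)) (size (reps _ _)) => x y /= sc sr.
have cov k : k \in comp (h :: M) -> exists2 r, r \in reps M h & dep (rt h) (rt r) (rt k).
  rewrite mem_comp inE negb_or => /andP[/andP[kh kM] k60].
  exact: reps_cover.
by move=> /(_ cov); lia.
Qed.

(** For h outside the star, 59 - |M| hyperplanes are covered by 21 points plus the 20 - |M| kept
    members of the star, so e >= 18; but all degrees are at most 17, so e <= 16. *)
Lemma star_step h M s : uniq (h :: M) -> {subset h :: M <= all60} ->
  s \in stars -> {subset M <= s} -> (13 <= size M)%N -> freeM (h :: M) -> h \in s.
Proof.
move=> uM M60 hs Ms M13 fM; apply/negPn/negP => nhs.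
have h60 : h \in all60 by rewrite M60 ?mem_head.
have [hM uM'] := andP uM.
have [d [Th [hTh [j0 [dj0 d17]]]]] := star_hbasis PP' P'P hs uM' Ms.
have [j [e [d' [Th' [dj _ _ hR]]]]] := exchange_step h60 hM hTh fM.
have e16 : (e <= 16)%N.
  rewrite -ltnS -dj; case: (eqVneq j j0) => [->|/d17//].
  by rewrite dj0; lia.
(* The kept hyperplanes of the star represent themselves, possibly redundantly; their number then
   cancels on both sides. *)
pose R := reps s h ++ [seq k <- s | k \notin M].
have /and3P[us /eqP ss /allP s60] := allP stars_ok _ hs.
have sR : {subset R <= comp (h :: M)}.
  move=> r; rewrite mem_cat mem_comp inE negb_or mem_filter.
  case/orP=> [/repsP[f fF /andP[rf rs]]|/andP[rM rs]].
    have [r60 rh _] := FlP h60 fF rf; rewrite rh r60 /= andbT.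
    by apply: contra rs; exact: Ms.
  by rewrite rM s60 // !andbT; apply: contraNneq nhs => <-.
have cov k : k \in comp (h :: M) -> exists2 r, r \in R & dep (rt h) (rt r) (rt k).
  rewrite mem_comp inE negb_or => /andP[/andP[kh kM] k60].
  case ks : (k \in s).
    exists k; first by rewrite mem_cat mem_filter ks kM orbT.
    have [f fF kf] := Fl_cover h60 k60 kh.
    by have [_ _] := FlP h60 fF kf; exact.
  have [r rr hr] := reps_cover h60 k60 kh (negbT ks).
  by exists r => //; rewrite mem_cat rr.
have := hR _ sR cov; rewrite size_cat.
have := size_diff uM' us Ms; have := size_comp uM M60; rewrite /= ss.
have : size (reps s h) = 21%N.
  have /orP[|/eqP <-] := allP (allP star_flats _ hs) _ h60; first by rewrite (negPf nhs).
  rewrite size_map size_filter; apply: eq_count => f.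
  by rewrite -has_predC.
by move=> ->; move: (size (comp _)) (size [seq _ <- _ | _]) => x y; lia.
Qed.

(** A localisation swallowed by h :: M but not by M contains h, and seen from h it would be a lost
    point. *)
Lemma valid_cons h M : {subset h :: M <= all60} -> valid M -> lost M h = 0%N ->
  valid (h :: M).
Proof.
move=> M60 vM l0.
have hF f : f \in Fl h -> has (fun k => k \notin M) f.
  move=> fF; apply: contraT; rewrite -all_predC => hf; move/eqP: l0.
  rewrite -leqn0 leqNgt -has_count => /hasP[]; exists f => //.
  by apply: sub_all hf => k /=; rewrite negbK.
have h60 : h \in all60 by rewrite M60 ?mem_head.
apply/allP => k; rewrite inE => /orP[/eqP->|kM]; apply/allP => f fF.
  have /hasP[j jf jM] := hF f fF; apply/hasP; exists j => //.
  by rewrite inE negb_or jM andbT; case: (FlP h60 fF jf).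
have k60 : k \in all60 by rewrite M60 // inE kM orbT.
have /hasP[j jf jM] := allP (allP vM _ kM) _ fF.
case: (eqVneq j h) => [jh|jh]; last first.
  by apply/hasP; exists j => //; rewrite inE negb_or jh.
(* The class f at k contains h, so the same localisation is viewed from h, where some element is
   still outside M. *)
rewrite jh in jf; have [f' f'F sub] := Fl_sym k60 fF jf.
have /hasP[i if' iM] := hF f' f'F.
have [_ ih _] := FlP h60 f'F if'.
have := sub i if'; rewrite inE => /orP[/eqP ik|iF]; first by rewrite ik kM in iM.
by apply/hasP; exists i => //; rewrite inE negb_or ih.
Qed.

Definition low_degrees (M : seq nat) (d : 'I_n -> nat) :=
  exists j, (d j <= maxn 17 (29 - size M))%N /\ forall i, i != j -> (d i <= 17)%N.

Lemma low_degreesP M d j : low_degrees M d -> (d j <= maxn 17 (29 - size M))%N.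
Proof.
move=> [j0 [dj0 d17]]; case: (eqVneq j j0) => [->//|/d17 h].
by rewrite leq_max h.
Qed.

(* As long as at most 13 hyperplanes are removed, only the largest exponent can
   drop, so that no point of the restriction is lost. *)
Lemma chain_valid M : uniq M -> {subset M <= all60} -> free_chain M -> (size M <= 13)%N ->
  valid M /\ exists d Th, hbasis (rows P (comp M)) d Th /\ low_degrees M d.
Proof.
elim: M => [|h M IH] uM M60 cM sM.
  have s0 : {subset [::] <= nth [::] stars 0} by [].
  have [d [Th [hTh [j [dj d17]]]]] :=
    star_hbasis PP' P'P (mem_nth [::] (isT : (0 < size stars)%N)) uM s0.
  split=> //; exists d, Th; split=> //; exists j; split=> //.
  by rewrite dj.
have [fM cM'] := cM; have /andP[hM uM'] := uM.
have M60' : {subset M <= all60} by move=> k kM; rewrite M60 // inE kM orbT.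
have h60 : h \in all60 by rewrite M60 ?mem_head.
have [vM [d [Th [hTh ld]]]] := IH uM' M60' cM' (ltnW sM).
have [j [e [d' [Th' [dj hTh' [d'j d'i] hR]]]]] := exchange_step h60 hM hTh fM.
have lb := lost_bound uM M60 hR.
have := low_degreesP j ld; rewrite dj.
rewrite /= in sM => ej.
(* Here |M| <= 12, so the largest degree is at most 29 - |M| and e <= 28 - |M|; [lost_bound] leaves
   no room. *)
have lost0 : lost M h = 0%N.
  by move: ej lb sM; move: (size M) (lost M h) => x z; lia.
split; first exact: valid_cons.
exists d', Th'; split=> //; have [j0 [dj0 d17]] := ld.
case: (eqVneq j j0) => [jj|jj].
  exists j; rewrite d'j; split.
    by move: ej sM; rewrite /=; move: (size M) => x; lia.
  by move=> i ij; rewrite d'i // d17 // -jj.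
(* Another degree, at most 17, can drop only when |M| = 12, and then the degree at j0 is at most 17
   too. *)
have := d17 j jj; rewrite dj => e17.
exists j0; rewrite d'i 1?eq_sym //; split.
  by move: dj0 lb e17 sM; rewrite /= lost0; move: (size M) => x; lia.
move=> i ij; case: (eqVneq i j) => [->|ij']; first by rewrite d'j ltnW.
by rewrite d'i // d17.
Qed.

(** At 13 removals the search leaves a star or two lost points at every remaining h. The latter
    contradicts 28 + [lost M h] <= e + 13 with e <= 16. Beyond 13, [star_step] keeps the chain in
    the star. *)
Lemma chain_star M : uniq M -> {subset M <= all60} -> free_chain M -> (13 < size M)%N ->
  exists2 s, s \in stars & {subset M <= s}.
Proof.
elim: M => [//|h M IH] uM M60 [fM cM] sM; have /andP[hM uM'] := uM.
have M60' : {subset M <= all60} by move=> k kM; rewrite M60 // inE kM orbT.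
have h60 : h \in all60 by rewrite M60 ?mem_head.
suff [s hs Ms] : exists2 s, s \in stars & {subset M <= s}.
  exists s => // k; rewrite inE => /orP[/eqP->|/Ms//].
  exact: star_step fM.
have [sM13|] := ltnP 13 (size M); first exact: IH.
move=> sM13; have {}sM13 : size M = 13 by apply/eqP; rewrite eqn_leq sM13.
have [|vM [d [Th [hTh ld]]]] := chain_valid uM' M60' cM; first by rewrite sM13.
have /orP[/hasP[s hs /allP Ms]|/allP/(_ h h60)] := valid13_good uM' M60' sM13 vM.
  by exists s.
rewrite (negPf hM) /= => l2.
have [j [e [d' [Th' [dj _ _ hR]]]]] := exchange_step h60 hM hTh fM.
have := lost_bound uM M60 hR; have := low_degreesP j ld; rewrite dj sM13.
by move: l2; move: (lost M h) => x; lia.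
Qed.

Lemma chain_size M : uniq M -> {subset M <= all60} -> free_chain M -> (size M <= 20)%N.
Proof.
move=> uM M60 cM; case: (ltnP 13 (size M)) => [/(chain_star uM M60 cM)[s hs Ms]|]; last by lia.
have /and3P[_ /eqP <- _] := allP stars_ok _ hs.
exact: uniq_leq_size.
Qed.

Lemma chain20 M : uniq M -> {subset M <= all60} -> free_chain M -> size M = 20 ->
  exists2 s, s \in stars & M =i s.
Proof.
move=> uM M60 cM sM; have [|s hs Ms] := chain_star uM M60 cM; first by rewrite sM.
exists s => //; have /and3P[_ /eqP ss _] := allP stars_ok _ hs.
by have [] := uniq_min_size uM Ms; rewrite ?sM ?ss.
Qed.

End Chain.

(** * Filtrations of the arrangement as chains of indices *)

Section Glue.

Variable C : numClosedFieldType.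
Local Notation V := 'cV[C]_4.
Local Notation n := (\dim {:V}).
Local Notation S := {mpoly C[n]}.
Local Notation P := (coordP C).

Definition rperp (k : nat) : {vspace V} := perp (gv C (rt k)).

Definition Arr (s : seq nat) : {fset {vspace V}} := [fset rperp k | k in s].

Lemma ArrP s H : reflect (exists2 k, k \in s & H = rperp k) (H \in Arr s).
Proof. exact: imfsetP. Qed.

Lemma rperp_inj : {in all60 &, injective rperp}.
Proof.
move=> h k h60 k60 /(perp_parallel (gv_rt_neq0 C h60)) hk.
by have /orP[/eqP//|/(@indep_not_parallel C)] := allP (allP indep_roots _ h60) _ k60.
Qed.

Lemma Arr_arrangement s : {subset s <= all60} -> is_arrangement (Arr s).
Proof.
move=> s60 H /ArrP[k /s60 k60 ->]; apply: perp_hyperplane.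
exact: gv_rt_neq0.
Qed.

Lemma card_Arr s : uniq s -> {subset s <= all60} -> #|` Arr s| = size s.
Proof.
move=> us s60; rewrite card_in_imfset /=; last first.
  by move=> h k /s60 h60 /s60 k60; exact: rperp_inj.
by rewrite (undup_id us).
Qed.

Lemma Arr_sub s t : {subset s <= t} -> Arr s `<=` Arr t.
Proof.
by move=> st; apply/fsubsetP => H /ArrP[k /st kt ->]; apply/ArrP; exists k.
Qed.

Lemma Arr_inD s f : {subset s <= all60} ->
  inD (forms (Arr s)) f <-> inD (rows P s) f.
Proof.
move=> s60; split; apply: inD_parallel.
- move=> _ /rowsP[k ks ->]; have [c c0 cE] := linear_form_perp (gv_rt_neq0 C (s60 k ks)).
  exists (row_of (linear_form (rperp k))).
    by apply: map_f; apply/ArrP; exists k.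
  by exists c^-1; rewrite cE scalerA mulVf // scale1r.
- move=> _ /mapP[H /ArrP[k ks ->] ->].
  have [c c0 cE] := linear_form_perp (gv_rt_neq0 C (s60 k ks)).
  by exists (row_at P k); [exact: mem_rows|exists c].
Qed.

Lemma basis_inD (l l' : seq 'rV[C]_n) m (Th : 'M[S]_(m, n)) :
  (forall f, inD l f <-> inD l' f) -> D_basis l Th -> D_basis l' Th.
Proof.
by move=> e [hD hB]; split=> [i|f /e]; [apply/e|exact: hB].
Qed.

Lemma Arr_free M : is_free (Arr (comp M)) <-> freeM P M.
Proof.
have s60 := @comp_sub M; rewrite (is_freeP (Arr_arrangement s60)).
split=> -[m [Th h]]; exists m, Th; apply: basis_inD h => f.
  exact: Arr_inD.
by split=> /(Arr_inD _ s60).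
Qed.

Lemma star_free s M : s \in stars -> uniq M -> {subset M <= s} -> is_free (Arr (comp M)).
Proof.
move=> hs uM Ms; apply/Arr_free; have [P' [PP' P'P]] := coordP_inv C.
have [d [Th [hTh _]]] := star_hbasis PP' P'P hs uM Ms.
exists n, Th; apply: hbasis_basis hTh.
exact: (simple_rows PP' (comp_uniq _) (@comp_sub _)).
Qed.

Lemma Arr_deletion M k : k \in comp M -> Arr (comp M) `\ rperp k = Arr (comp (k :: M)).
Proof.
rewrite mem_comp => /andP[kM k60]; apply/fsetP => H; rewrite !inE.
apply/andP/ArrP => [[nH /ArrP[j jM HE]]|[j]].
  exists j => //; rewrite mem_comp inE negb_or.
  move: jM; rewrite mem_comp => /andP[-> ->]; rewrite !andbT.
  by apply: contraNneq nH => jk; rewrite HE jk.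
rewrite mem_comp inE negb_or => /andP[/andP[jk jM] j60] ->; split.
  by apply: contraNneq jk => /(rperp_inj j60 k60)/eqP.
by apply/ArrP; exists j => //; rewrite mem_comp jM.
Qed.

(** The cardinality condition makes each step drop exactly one hyperplane, whose index is put in
    front of the list. *)
Lemma filtration_chain A (F : nat -> {fset {vspace V}}) N :
  A = Arr (comp [::]) -> F 0%N = A ->
  (forall i, (i <= N)%N -> is_free (F i)) ->
  (forall i, (i < N)%N -> F i.+1 `<` F i) ->
  (forall i, (i <= N)%N -> (#|` F i| + i)%N = #|` A|) ->
  exists M, [/\ size M = N, uniq M, {subset M <= all60}, F N = Arr (comp M) & free_chain P M].
Proof.
move=> AE F0 hfree hsub hcard; move: (leqnn N).
elim: {1 3 4}N => [_|i IH iN]; first by exists [::]; rewrite F0 AE.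
have [M [sM uM M60 FM cM]] := IH (ltnW iN).
have := hsub _ iN; rewrite fproperE => /andP[/fsubsetP sub /fsubsetPn[H HF nH]].
have c1 : #|` F i| = #|` F i.+1|.+1.
  by apply/eqP; rewrite -(eqn_add2r i) hcard ?(ltnW iN) // addSnnS hcard.
have [k kM HE] : exists2 k, k \in comp M & H = rperp k by apply/ArrP; rewrite -FM.
have FE : F i.+1 = F i `\ H.
  apply/eqP; rewrite eqEfcard; apply/andP; split.
    apply/fsubsetP => H' H'F; rewrite !inE sub // andbT.
    by apply: contraNneq nH => <-.
  have := cardfsD1 H (F i); rewrite HF add1n c1 => /eqP.
  by rewrite eqSS => /eqP <-.
move: (kM); rewrite mem_comp => /andP[nkM k60].
have FkM : F i.+1 = Arr (comp (k :: M)) by rewrite FE FM HE Arr_deletion.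
exists (k :: M); split=> //=.
- by rewrite sM.
- by rewrite nkM.
- by move=> j; rewrite inE => /orP[/eqP->|/M60].
- by split=> //; apply/Arr_free; rewrite -FkM; exact: hfree.
Qed.

(** The star is removed in list order; every stage is free by [star_free]. *)
Lemma star_filtration s : s \in stars ->
  free_filtration_sub (Arr (comp [::])) (Arr (comp s)).
Proof.
move=> hs; have /and3P[us /eqP ss /allP s60] := allP stars_ok _ hs.
have tk i : uniq (take i s) /\ {subset take i s <= s}.
  by split; [exact: take_uniq|move=> k; exact: mem_take].
have t60 i : {subset take i s <= all60} by move=> k /(proj2 (tk i))/s60.
have card i : (i <= 20)%N -> (#|` Arr (comp (take i s))| + i = 60)%N.
  move=> i20; rewrite card_Arr ?comp_uniq //; last exact: comp_sub.
  by rewrite -[X in (_ + X)%N](@size_takel i _ s) ?ss // size_comp //; case: (tk i).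
exists 20, (fun i => Arr (comp (take i s))); split.
- by rewrite take0.
- by rewrite take_oversize ?ss.
- by move=> i _; apply: (star_free hs); case: (tk i).
- move=> i i20; have sub : Arr (comp (take i.+1 s)) `<=` Arr (comp (take i s)).
    apply: Arr_sub; apply: comp_anti => k.
    by rewrite -(take_takel s (leqnSn i)); exact: mem_take.
  rewrite fproperEcard; apply/andP; split; first exact: sub.
  have lt (a b : nat) : (a + i.+1 = 60)%N -> (b + i = 60)%N -> (a < b)%N by lia.
  exact: lt (card _ i20) (card _ (ltnW i20)).
- have e0 := card 0%N isT; rewrite take0 addn0 in e0.
  by move=> i i20; exact: etrans (card i i20) (esym e0).
Qed.

(** When B is built by addition, its deletion is free and inductively free, so a filtration ending
    in B is prolonged by one step. *)
Lemma inductively_free_fset0 (W : vectType C) (B : {fset {vspace W}}) :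
  inductively_free B -> forall A, free_filtration_sub A B -> free_filtration_sub A fset0.
Proof.
elim=> [W' A //|W' B' H0 e' e'' arrB H0B _ _ _ IH _ expd _ A [N [F [F0 FN hfree hsub hcard]]]].
apply: IH; exists N.+1, (fun i => if (i <= N)%N then F i else deletion B' H0); split.
- by rewrite leq0n.
- by rewrite ltnn.
- move=> i iN; case: (leqP i N) => [|_]; first exact: hfree.
  apply: is_exp_free expd => H; rewrite !inE => /andP[_].
  exact: arrB.
- move=> i; rewrite ltnS => iN; rewrite iN; case: (eqVneq i N) => [->|ne].
    by rewrite ltnn FN fproperD1.
  by have lt : (i < N)%N; [rewrite ltn_neqAle ne|rewrite lt; exact: hsub].
- move=> i iN; case: (leqP i N) => [|Ni]; first exact: hcard.
  have -> : i = N.+1 by apply/eqP; rewrite eqn_leq iN.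
  by rewrite -(hcard N) // FN (cardfsD1 H0 B') H0B addnS add1n addSn.
Qed.

(** A filtration down to the empty arrangement would remove 60 hyperplanes, beyond the bound 20 of
    [chain_size]. *)
Lemma filtration_not_IF B :
  free_filtration_sub (Arr (comp [::])) B -> ~ inductively_free B.
Proof.
move=> hB hIF; have [N [F [F0 FN hfree hsub hcard]]] := inductively_free_fset0 hIF hB.
have [M [sM uM M60 FM cM]] := filtration_chain (erefl _) F0 hfree hsub hcard.
have [P' [PP' P'P]] := coordP_inv C.
have M20 := chain_size PP' P'P uM M60 cM.
have := card_Arr (comp_uniq M) (@comp_sub M); rewrite -FM FN cardfs0 => s0.
by have := size_comp uM M60; rewrite -s0 add0n => s60; rewrite s60 in M20.
Qed.

(** The factor 1/2 is 2 divided by the norm 4 of the root. *)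
Definition refl_mx (h : nat) : 'M[C]_4 :=
  1%:M - 2%:R^-1 *: (gc C (vconj (rt h)) *m gv C (rt h)).

Lemma refl_mxK h : h \in all60 -> refl_mx h *m refl_mx h = 1%:M.
Proof.
move=> h60; rewrite /refl_mx; set N := gc C _ *m _.
have NN : N *m N = 4%:R *: N.
  rewrite /N -mulmxA [gv C _ *m (_ *m _)]mulmxA gdotE.
  have /geqbP -> := allP norm4 _ h60.
  have -> : gz C gfour = 4%:R by rewrite /gz /= mulr0 addr0.
  by rewrite mul_scalar_mx -scalemxAr.
rewrite mulmxBl mul1mx mulmxBr mulmx1 -scalemxAl -scalemxAr NN.
clearbody N; apply/matrixP => i j; rewrite !mxE; by field.
Qed.

Lemma refl_rperp h k : h \in all60 -> k \in all60 ->
  (linfun (mulmx (refl_mx h) : V -> V) @: rperp k)%VS = rperp (tau h k).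
Proof.
move=> h60 k60; have /hasP[u uu /andP[_ /allP e]] := allP (allP tau_refl _ h60) _ k60.
have u0 : gz C u != 0.
  by apply: gz_neq0; move: uu; rewrite !inE => /or4P[] /eqP->.
have E : gv C (rt (tau h k)) = gz C u *: (gv C (rt k) *m refl_mx h).
  rewrite /refl_mx mulmxBr mulmx1 -scalemxAr mulmxA gdotE mul_scalar_mx.
  apply/rowP => j; have /geqbP/(congr1 (gz C)) := e j (mem_ord4 j).
  rewrite !gzM gzD gzN !gzM gz2 !mxE => e2.
  have n2 : 2%:R != 0 :> C by rewrite pnatr_eq0.
  by apply: (mulfI n2); rewrite e2; field.
rewrite /rperp (parallel_perp u0 E).
apply/vspaceP => y; rewrite memv_perp; apply/memv_imgP/eqP => [[x]|hy].
  rewrite memv_perp => /eqP hx ->; rewrite lfunE /= -mulmxA [_ *m (_ *m x)]mulmxA.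
  by rewrite refl_mxK // mul1mx.
exists (refl_mx h *m y); last by rewrite lfunE /= mulmxA refl_mxK // mul1mx.
by rewrite memv_perp mulmxA hy.
Qed.

Lemma star_isomorphic s : s \in stars -> isomorphic (Arr (comp s)) (Arr (comp star0)).
Proof.
move=> hs; have /hasP[h h60 hp] := allP star_refl _ hs.
have fK : cancel (mulmx (refl_mx h) : V -> V) (mulmx (refl_mx h)).
  by move=> x; rewrite mulmxA refl_mxK // mul1mx.
exists (linfun (mulmx (refl_mx h) : V -> V)); split.
- apply/eqP; rewrite -subv0; apply/subvP => x; rewrite memv_ker lfunE /= memv0.
  by move=> /eqP e; rewrite -(fK x) e mulmx0.
- apply/eqP; rewrite eqEsubv subvf /=; apply/subvP => x _.
  by apply/memv_imgP; exists (refl_mx h *m x); rewrite ?memvf // lfunE /= fK.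
- apply/fsetP => H; apply/imfsetP/ArrP => [[_ /ArrP[k kC ->] ->]|[k]].
    exists (tau h k); last by apply: refl_rperp => //; exact: comp_sub kC.
    by rewrite -(perm_mem hp); apply: map_f.
  rewrite -(perm_mem hp) => /mapP[j jC ->] ->; exists (rperp j).
    by apply/ArrP; exists j.
  by rewrite refl_rperp //; exact: comp_sub jC.
Qed.

End Glue.

(** * The given arrangements G29 and G31 in terms of root lines *)

Section Identification.

Variable C : numClosedFieldType.
Local Notation V := 'cV[C]_4.

Lemma proportional_perp v j : proportional v j -> perp (gv C v) = rperp C j.
Proof.
move=> /hasP[c cs /allP h].
have c0 : gz C c != 0.
  apply: gz_neq0; move: cs; rewrite mem_cat !inE.
  by move=> /orP[/orP[]|/or4P[]] /eqP->.
apply/esym/(@parallel_perp C _ _ (gz C c)) => //; apply/rowP => i.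
by have /geqbP/(congr1 (gz C)) := h i (mem_ord4 i); rewrite gzM !mxE.
Qed.

Lemma same_lines_Arr (l : seq (seq gint)) s (A : {fset {vspace V}}) :
  same_lines l s -> (forall H, H \in A <-> exists2 v, v \in l & H = perp (gv C v)) ->
  A = Arr C s.
Proof.
move=> /andP[/allP h1 /allP h2] hA; apply/fsetP => H; apply/idP/ArrP.
  move=> /hA[v /h1/hasP[j js vj] ->]; exists j => //.
  exact: proportional_perp.
move=> [j js ->]; apply/hA; have /hasP[v vl vj] := h2 j js.
by exists v => //; rewrite (proportional_perp vj).
Qed.

Lemma gz_ipow k : (k < 4)%N -> gz C (ipow k) = 'i ^+ k.
Proof.
have i2 : 'i ^+ 2 = -1 :> C := sqrCi C.
case: k => [|[|[|[|k]]]] // _.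
- by rewrite gz1 expr0.
- by rewrite /gz /= /zc /= add0r mulr1 expr1.
- by rewrite i2 /gz /= mulr0 addr0.
- by rewrite exprS i2 mulrN1 /gz /= add0r mulrN1.
Qed.

Lemma lt4 k : k \in iota 0 4 -> (k < 4)%N.
Proof. by rewrite mem_iota. Qed.

Lemma gz_inj x y : gz C x = gz C y -> x = y.
Proof.
move=> e; have : gz C (gadd x (gopp y)) = 0 by rewrite gzD gzN e subrr.
case: x y {e} => a b [c d] /gz_eq0 [] /= h1 h2.
by congr (_, _); lia.
Qed.

Lemma ker_diffE (p q k : 'I_4) : (p < q)%N ->
  ker_diff C p q k = perp (gv C (diffv p q k)).
Proof.
move=> pq; congr perp; apply/rowP => i.
rewrite !mxE !eqxx /diffv ent_map -!val_eqE /=.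
case: (eqVneq (i : nat) p) => [ip|_]; last first.
  case: (eqVneq (i : nat) q) => _; last by rewrite mulr0 subr0 gz0.
  by rewrite gzN gz_ipow // mulr1 sub0r.
by rewrite ip ltn_eqF // mulr0 subr0 gz1.
Qed.

Lemma unitvE (p : 'I_4) : delta_mx 0 p = gv C (unitv p).
Proof.
apply/rowP => i; rewrite !mxE eqxx /unitv ent_map -val_eqE /=.
by case: ((i : nat) =P p) => _; rewrite ?gz1 ?gz0.
Qed.

Definition quad_of (k : {ffun 'I_4 -> 'I_4}) : seq nat :=
  [:: (k (@Ordinal 4 0 isT) : nat); (k (@Ordinal 4 1 isT) : nat);
      (k (@Ordinal 4 2 isT) : nat); (k (@Ordinal 4 3 isT) : nat)].

Lemma nth_quad_of k (i : 'I_4) : nth 0%N (quad_of k) i = k i.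
Proof.
by case: i => -[|[|[|[|m]]]] h //=; congr (nat_of_ord (k _)); exact: val_inj.
Qed.

Lemma gz_quad k (i : 'I_4) : gz C (ipow (nth 0%N (quad_of k) i)) = 'i ^+ k i.
Proof. by rewrite nth_quad_of gz_ipow. Qed.

Lemma gz_prodq (k : {ffun 'I_4 -> 'I_4}) :
  gz C (prodq (quad_of k)) = \prod_(i < 4) 'i ^+ k i.
Proof.
under eq_bigr => i _ do rewrite -gz_quad.
by rewrite !big_ord_recl big_ord0 mulr1 /prodq !gzM.
Qed.

Lemma mem_quads k : \prod_(i < 4) ('i : C) ^+ (k : {ffun 'I_4 -> 'I_4}) i = 1 ->
  quad_of k \in quads.
Proof.
rewrite -gz_prodq -(gz1 C) => /gz_inj e; rewrite mem_filter e [geqb _ _]/= andTb.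
apply: allpairs_f; first exact: mem_ord4.
apply: allpairs_f; first exact: mem_ord4.
by apply: allpairs_f; exact: mem_ord4.
Qed.

Lemma quadsP q : q \in quads -> exists k, q = quad_of k /\
  \prod_(i < 4) ('i : C) ^+ (k : {ffun 'I_4 -> 'I_4}) i = 1.
Proof.
rewrite mem_filter => /andP[/geqbP e /allpairsP[[a q1] [/= ha hq1 qE]]].
move/allpairsP: hq1 => [[b q2] [/= hb /allpairsP[[c d] [/= hc hd q2E]] q1E]].
rewrite q1E q2E in qE.
move: (lt4 ha) (lt4 hb) (lt4 hc) (lt4 hd) => {}ha {}hb {}hc {}hd.
exists [ffun i : 'I_4 => inord (nth 0%N q i)].
have E : q = quad_of [ffun i : 'I_4 => inord (nth 0%N q i)].
  by rewrite /quad_of !ffunE qE /= !inordK.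
by split=> //; rewrite -gz_prodq -E e gz1.
Qed.

Lemma monomial_mxE (s : 'S_4) k (v : 'rV[C]_4) i :
  (monomial_mx C s k *m v^T)^T 0 i = 'i ^+ k i * v 0 (s i).
Proof.
rewrite !mxE (bigD1 (s i)) //= !mxE eqxx mulr1n big1 ?addr0 // => j /negPf ji.
by rewrite !mxE ji mulr0n mul0r.
Qed.

Lemma orbitP (v : 'rV[C]_4) H :
  H \in [fset perp a | a in G444_orbit v] <->
  exists s k, \prod_(i < 4) ('i : C) ^+ (k : {ffun 'I_4 -> 'I_4}) i = 1 /\
    H = perp (\row_i ('i ^+ k i * v 0 ((s : 'S_4) i))).
Proof.
split=> [/imfsetP[a /imfsetP[g /imfsetP[[s k] /= + ->] ->] ->]|[s [k [hk ->]]]].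
  rewrite !inE /= => /eqP hk; exists s, k; split=> //.
  by congr perp; apply/rowP => i; rewrite monomial_mxE mxE.
apply/imfsetP; exists ((monomial_mx C s k *m v^T)^T).
  apply/imfsetP; exists (monomial_mx C s k) => //.
  apply/imfsetP; exists (s, k) => //=.
  by rewrite !inE /= hk.
by congr perp; apply/rowP => i; rewrite monomial_mxE mxE.
Qed.

Lemma mem_A_G29 H :
  H \in A_G29 C <-> exists2 v, v \in forms29 & H = perp (gv C v).
Proof.
have phE (k : {ffun 'I_4 -> 'I_4}) : \row_i ('i ^+ k i * (const_mx 1 : 'rV[C]_4) 0 i) = gv C (phasev (quad_of k)).
  by apply/rowP => i; rewrite !mxE mulr1 /phasev ent_map gz_quad.
rewrite /A_G29 in_fsetU; split.
  case/orP=> [/imfsetP[[[p q] k] /= + ->]|/orbitP[s [k [hk ->]]]].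
    rewrite !inE /= => pq; exists (diffv p q k); last exact: ker_diffE.
    rewrite mem_cat; apply/orP; left; apply/mapP; exists (p : nat, q : nat, k : nat) => //.
    rewrite mem_filter; apply/andP; split; first exact: pq.
    by apply: allpairs_f (mem_ord4 k); apply: allpairs_f; exact: mem_ord4.
  exists (phasev (quad_of k)).
    by rewrite mem_cat; apply/orP; right; apply: map_f; exact: mem_quads.
  by rewrite -phE; congr perp; apply/rowP => i; rewrite !mxE.
case=> v; rewrite mem_cat => /orP[/mapP[t ht ->]|/mapP[q /quadsP[k [-> hk]] ->]] ->.
  move: ht; rewrite mem_filter => /andP[lt /allpairsP[[pq k] [/= hpq hk tE]]].
  move/allpairsP: hpq => [[p q] [/= hp hq pqE]]; rewrite pqE in tE.
  rewrite tE /= in lt *; move: (lt4 hp) (lt4 hq) (lt4 hk) => {}hp {}hq {hk} hk'.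
  apply/orP; left; apply/imfsetP.
  exists (Ordinal hp, Ordinal hq, Ordinal hk'); first by rewrite !inE.
  by rewrite (@ker_diffE (Ordinal hp) (Ordinal hq) (Ordinal hk')).
apply/orP; right; apply/orbitP; exists 1%g, k; split=> //.
by rewrite -phE; congr perp; apply/rowP => i; rewrite !mxE.
Qed.

Lemma A_G29E : A_G29 C = Arr C (comp star0).
Proof. exact: (same_lines_Arr forms29_lines mem_A_G29). Qed.

Lemma A_G31E : A_G31 C = Arr C (comp [::]).
Proof.
have ngE (k : {ffun 'I_4 -> 'I_4}) (s : 'S_4) (i0 : 'I_4) : s i0 = 0 ->
    \row_i ('i ^+ k i * (\row_j (if j == 0 then -1 else 1) : 'rV[C]_4) 0 (s i))
    = gv C (negv i0 (phasev (quad_of k))).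
  move=> si0; apply/rowP => i; rewrite !mxE /negv ent_map /phasev ent_map -si0.
  rewrite (inj_eq perm_inj) val_eqE; case: eqP => _.
    by rewrite gzN gz_quad mulrN1.
  by rewrite gz_quad mulr1.
apply: (same_lines_Arr forms31_lines) => H; rewrite /A_G31 2!in_fsetU; split.
  case/orP=> [/orP[/mem_A_G29[v hv ->]|/imfsetP[p _ ->]]|/orbitP[s [k [hk ->]]]].
  - by exists v => //; rewrite !mem_cat -mem_cat hv.
  - exists (unitv p); last by rewrite unitvE.
    rewrite mem_cat; apply/orP; left; rewrite mem_cat; apply/orP; right.
    by apply: map_f; exact: mem_ord4.
  (* The sign ends up at the index that s sends to 0. *)
  - exists (negv (s^-1%g 0) (phasev (quad_of k))); last by rewrite (ngE k s (s^-1%g 0)) ?permKV.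
    rewrite mem_cat; apply/orP; right.
    apply: (allpairs_f (fun (i0 : nat) q => negv i0 (phasev q))); first exact: mem_ord4.
    exact: mem_quads.
case=> v; rewrite mem_cat => /orP[|].
  rewrite mem_cat => /orP[hv ->|/mapP[p hp ->] ->].
    by apply/orP; left; apply/orP; left; apply/mem_A_G29; exists v.
  apply/orP; left; apply/orP; right; have {}hp := lt4 hp.
  by apply/imfsetP; exists (Ordinal hp) => //; rewrite unitvE.
case/allpairsP=> [[i0 q] [/= hi /quadsP[k [qE hk]] ->]] ->.
have {}hi := lt4 hi; apply/orP; right; apply/orbitP.
exists (tperm (Ordinal hi) 0), k; split=> //.
by rewrite qE -[i0]/(nat_of_ord (Ordinal hi)) (ngE k _ (Ordinal hi)) ?tpermL.
Qed.

End Identification.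

Theorem proposition3p8 (R : realType) :
  (forall B,
     smallest_free_filtration_sub (A_G31 R[i]) B ->
     isomorphic B (A_G29 R[i])) /\
  ~ inductively_free (A_G31 R[i]) /\
  ~ inductively_free (A_G29 R[i]) /\
  (forall B, free_filtration_sub (A_G31 R[i]) B -> ~ inductively_free B).
Proof.
rewrite A_G31E A_G29E; have hs0 : star0 \in stars by exact: mem_nth.
have h29 := star_filtration R[i] hs0.
split; [|split; [|split]].
- move=> B [[N [F [F0 FN hfree hsub hcard]]] hmin].
  have [M [sM uM M60 FM cM]] := filtration_chain (erefl _) F0 hfree hsub hcard.
  have [P' [PP' P'P]] := coordP_inv R[i].
  have M20 := chain_size PP' P'P uM M60 cM.
  have BE : B = Arr R[i] (comp M) by rewrite -FN.
  (* Minimality against the complement of [star0] gives |M| >= 20, and [chain_size] gives the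
     converse bound. *)
  have := hmin _ h29; rewrite BE !card_Arr ?comp_uniq //; try exact: comp_sub.
  have /and3P[us /eqP ss /allP s60] := allP stars_ok _ hs0.
  have := size_comp us s60; have := size_comp uM M60; rewrite ss.
  move=> e1 e2 e3; have {e1 e2 e3} sM20 : size M = 20.
    move: e1 e2 e3 M20; move: (size (comp M)) (size (comp star0)) (size M) => *; lia.
  have [s hs Ms] := chain20 PP' P'P uM M60 cM sM20.
  by rewrite (comp_eq Ms); exact: star_isomorphic.
(* The whole arrangement ends the filtration of length 0. *)
- apply: (@filtration_not_IF R[i]); exists 0%N, (fun=> Arr R[i] (comp [::])); split=> //.
  + by move=> i _; apply: (star_free R[i] hs0).
  + by move=> [|i] //; rewrite addn0.
- exact: filtration_not_IF.
- by move=> B; exact: filtration_not_IF.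
Qed.
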